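(* Let $q$ be a prime power, and let $m, r$ be nonnegative integers such that $m\ge 1$ and $0\le r\le m(q-1)$. Then every $\mathbb{N}$-graded minimal free resolution of the Stanley-Reisner ring $R_C$ associated to the (generalized) Reed-Muller code $C=\mathcal{RM}_q(r,m)$ is pure if and only if $m=1$ or $r\le 1$ or $r\ge m(q-1)-1$.
   Context: Let $\mathbb{F}_q$ be the finite field with $q$ elements, and $\mathbb{N}$ the set of nonnegative integers. An $[n,k]_q$-code is a $k$-dimensional $\mathbb{F}_q$-linear subspace of $\mathbb{F}_q^n$, where $1\le k\le n$. Reed-Muller codes. For integers $m\ge 1$ and $0\le r\le m(q-1)$, let $$V_q(r,m)=\{f\in\mathbb{F}_q[X_1,\dots,X_m] : \deg(f)\le r \text{ and } \deg_{X_i}(f)<q \text{ for } i=1,\dots,m\}.$$ Fix an ordering $\mathsf{P}_1,\dots,\mathsf{P}_{q^m}$ of the elements of $\mathbb{F}_q^m$. The Reed-Muller code $\mathcal{RM}_q(r,m)$ of order $r$ is the image of the linear map $V_q(r,m)\to\mathbb{F}_q^{q^m}$, $f\mapsto (f(\mathsf{P}_1),\dots,f(\mathsf{P}_{q^m}))$; it is a linear code of length $q^m$. Stanley-Reisner ring of a code. Let $C$ be an $[n,k]_q$-code with parity check matrix $H$ (an $(n-k)\times n$ matrix over $\mathbb{F}_q$ of rank $n-k$ whose null space is $C$), with columns $H_1,\dots,H_n$. Let $\Delta_C$ be the simplicial complex on $\{1,\dots,n\}$ whose faces are the subsets $\{i_1,\dots,i_t\}$ for which $H_{i_1},\dots,H_{i_t}$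 are linearly independent (the empty set being a face); it does not depend on the choice of $H$. Let $R=\mathbb{F}_q[x_1,\dots,x_n]$ with its standard grading and let $I_C$ be the ideal of $R$ generated by the monomials $x_{i_1}\cdots x_{i_t}$ where $\{i_1,\dots,i_t\}$ ranges over the subsets of $\{1,\dots,n\}$ that are not in $\Delta_C$. The Stanley-Reisner ring associated to $C$ is $R_C=R/I_C$. Purity. $R_C$ admits an $\mathbb{N}$-graded minimal free resolution over $R$ of the form $F_k\to F_{k-1}\to\cdots\to F_1\to F_0\to R_C\to 0$ (of length $k=\dim C$), where $F_0=R$ and $F_i=\bigoplus_{j\in\mathbb{Z}}R(-j)^{\beta_{i,j}}$ for $0\le i\le k$. The resolution is called pure if there are integers $d_0,d_1,\dots,d_k$ such that for each $i=0,1,\dots,k$, $\beta_{i,j}\ne 0$ if and only if $j=d_i$. The numbers $\beta_{i,j}$, and hence purity, do not depend on the choice of the minimal free resolution. *)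

(* Defs.v *)
From mathcomp Require Export all_boot all_order all_algebra.
From mathcomp.multinomials Require Export mpoly.

Set Implicit Arguments.
Unset Strict Implicit.
Unset Printing Implicit Defensive.

Import GRing.Theory.
Local Open Scope ring_scope.

(* [msize f] is deg f + 1, and 0 for f = 0, so the first conjunct is deg f <= r. *)
Definition rm_poly (F : finFieldType) (m r : nat) (f : {mpoly F[m]}) : Prop :=
  (msize f <= r.+1)%N /\
  (forall (mon : 'X_{1..m}) (i : 'I_m), mon \in msupp f -> (mon i < #|F|)%N).

Definition evaluation (F : finFieldType) (m N : nat) (P : 'I_N -> 'rV[F]_m)
    (f : {mpoly F[m]}) : 'rV[F]_N :=
  \row_j f.@[fun i => P j ord0 i].

Definition is_reed_muller (F : finFieldType) (m r N : nat)
    (P : 'I_N -> 'rV[F]_m) (C : {vspace 'rV[F]_N}) : Prop :=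
  forall c : 'rV[F]_N,
    c \in C <-> exists2 f : {mpoly F[m]}, rm_poly r f & c = evaluation P f.

Definition parity_check (F : fieldType) (n : nat) (C : {vspace 'rV[F]_n})
    (H : 'M[F]_(n - \dim C, n)) : Prop :=
  \rank H = (n - \dim C)%N /\
  (forall c : 'rV[F]_n, c \in C <-> H *m c^T = 0).

(* [free] is applied to the family of columns, not to the set of their values,
   so two equal columns with distinct indices are dependent. *)
Definition code_face (F : fieldType) (s n : nat) (H : 'M[F]_(s, n))
    (S : {set 'I_n}) : bool :=
  free [seq col i H | i <- enum S].

Definition sr_ideal (F : fieldType) (n : nat) (face : {set 'I_n} -> bool)
    (f : {mpoly F[n]}) : Prop :=
  exists c : {set 'I_n} -> {mpoly F[n]},
    f = \sum_(S : {set 'I_n} | ~~ face S) c S * \prod_(i in S) 'X_i.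

(* A sequence ... -> F_2 -> F_1 -> F_0 = R of maps between graded free modules
   over R = F[x_1, ..., x_n].  The list of integers [:: j_1; ...; j_b] encodes
   R(-j_1) + ... + R(-j_b), i.e. it lists the degrees of the basis elements;
   [syzygies i] is the list for F_(i+1).  Elements are row vectors and maps act
   by right multiplication. *)
Definition twists_of (syz : nat -> seq int) (i : nat) : seq int :=
  if i is j.+1 then syz j else [:: 0].

Record free_seq (F : fieldType) (n : nat) := FreeSeq {
  syzygies : nat -> seq int;
  diff : forall i : nat,
    'M[{mpoly F[n]}]_(size (twists_of syzygies i.+1), size (twists_of syzygies i))
}.

Definition twists (F : fieldType) (n : nat) (E : free_seq F n) (i : nat) :
  seq int := twists_of (syzygies E) i.

Definition betti (F : fieldType) (n : nat) (E : free_seq F n) (i : nat)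
  (j : int) : nat := count_mem j (twists E i).

(* Every map preserves degrees: x_1, ..., x_n have degree 1, so the (a, b) entry
   is homogeneous of degree (degree of a) - (degree of b), hence 0 if this is
   negative. *)
Definition graded_maps (F : fieldType) (n : nat) (E : free_seq F n) : Prop :=
  forall (i : nat) (a : 'I_(size (twists E i.+1))) (b : 'I_(size (twists E i)))
    (mon : 'X_{1..n}),
    mon \in msupp (diff E i a b) ->
    (mdeg mon)%:Z = (twists E i.+1)`_a - (twists E i)`_b.

(* Exactness of ... -> F_1 -> F_0 = R -> R/I -> 0, where R -> R/I is the
   canonical projection: at F_0 this says that the image of F_1 is I. *)
Definition exact_over (F : fieldType) (n : nat) (I : {mpoly F[n]} -> Prop)
    (E : free_seq F n) : Prop :=
  (forall f : {mpoly F[n]},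
     I f <-> exists w : 'rV[{mpoly F[n]}]_(size (twists E 1)),
               (f%:M : 'rV[{mpoly F[n]}]_1) = w *m diff E 0) /\
  (forall (i : nat) (v : 'rV[{mpoly F[n]}]_(size (twists E i.+1))),
     v *m diff E i = 0 <->
     exists w : 'rV[{mpoly F[n]}]_(size (twists E i.+2)), v = w *m diff E i.+1).

(* The image of F_(i+1) lies in (x_1, ..., x_n) F_i. *)
Definition minimal_maps (F : fieldType) (n : nat) (E : free_seq F n) : Prop :=
  forall (i : nat) (a : 'I_(size (twists E i.+1))) (b : 'I_(size (twists E i))),
    (diff E i a b)@_0%MM = 0.

(* Minimal graded free resolutions F_k -> ... -> F_0 = R of R/I; with F_(k+1) = 0,
   exactness at F_k is injectivity of the leftmost map. *)
Definition minimal_graded_resolution (F : fieldType) (n k : nat)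
    (I : {mpoly F[n]} -> Prop) (E : free_seq F n) : Prop :=
  [/\ graded_maps E, exact_over I E, minimal_maps E
    & forall i : nat, (k < i)%N -> twists E i = [::]].

Definition pure (F : fieldType) (n k : nat) (E : free_seq F n) : Prop :=
  exists d : nat -> int, forall i : nat, (i <= k)%N ->
    forall j : int, betti E i j <> 0%N <-> j = d i.

(* Main.v *)
(* The faces are the sets of nullity 0, where the nullity nu T of a set T of
   positions is the dimension of the space of codewords supported in T.

   The degrees of the i-th module of a minimal resolution are the cardinals of the
   coloop-free sets of nullity i: they are read off the Koszul homology of R_C,
   which in a squarefree multidegree T is the cohomology of the independence
   complex on T, concentrated in the top degree by deletion and contraction, and
   zero if T has a coloop. Hence the resolution is pure if coloop-free sets of
   equal nullity are equicardinal, which holds for uniform matroids (m = 1, r = 0,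
   r >= m(q-1) - 1) and, by counting, for affine functions (r = 1).

   In the other cases circuits of different sizes, which are degrees of minimal
   generators, give a resolution that is not pure: products A_1 x ... x A_m with
   \sum_i (q - #|A_i|) = r if q > 2, such a product and the cylinder over the
   quadric x_0 x_1 + x_2 x_3 = 1 if q = 2. Their being circuits rests on
   \sum_x f(x) = 0 for deg f < m(q-1). A minimal resolution of length dim C is
   built multidegree by multidegree, choosing each time a minimal set of
   generators of the cycles. *)
Require Import Defs.
From mathcomp Require Import all_field zify ring.
From Stdlib Require Import ClassicalEpsilon.

Set Implicit Arguments.
Unset Strict Implicit.
Unset Printing Implicit Defensive.

Import GRing.Theory.
Local Open Scope ring_scope.

(** * Nullity functions of matroids *)

(** The assumption of purity quantifies over minimal resolutions, so it yields something only once
    one of length [dim C] is exhibited. Conversely, the degrees have to be controlled for an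
    arbitrary resolution, and purity also asks that no module up to position [dim C] be zero: no
    resolution is shorter than the nullity of the whole set.

    The arguments run over abstract functions [nu T], the cardinal of T minus its rank, because
    contraction is then just W |-> nu (e |: W), on subsets of the same index set; the third clause
    below says that an element in the closure of S is in the closure of every larger T. A
    multidegree that is not squarefree is treated by contracting the variables which a Koszul
    generator cannot use up.

    For q = 2 each q - #|A_i| is 0 or 1, so the product circuits for a given r all have 2^(m-r)
    points; this forces a circuit of another shape, the quadric. *)

Definition nullity (n : nat) (nu : {set 'I_n} -> nat) : Prop :=
  [/\ nu set0 = 0%N,
      forall (T : {set 'I_n}) e, (nu T <= nu (e |: T) <= (nu T).+1)%N
    & forall (S T : {set 'I_n}) e,
        S \subset T -> e \notin T -> (nu S < nu (e |: S))%N ->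
        (nu T < nu (e |: T))%N].

Definition coloop_free (n : nat) (nu : {set 'I_n} -> nat) (T : {set 'I_n}) :
  Prop := forall e, e \in T -> (nu (T :\ e) < nu T)%N.

Section Nullity.
Variables (n : nat) (nu : {set 'I_n} -> nat).
Hypothesis nuP : nullity nu.
Implicit Types (A B S T U W : {set 'I_n}).

Lemma nullity_set0 : nu set0 = 0%N. Proof. by case: nuP. Qed.

Lemma nullity_addS T U : (nu T <= nu (T :|: U) <= nu T + #|U|)%N.
Proof.
case: nuP => _ h2 _; move: {2}#|U| (leqnn #|U|) => k.
elim: k U => [|k IH] U.
  by rewrite leqn0 cards_eq0 => /eqP ->; rewrite setU0 cards0 addn0 !leqnn.
case: (set_0Vmem U) => [-> _|[e eU]]; first by rewrite setU0 cards0 addn0 !leqnn.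
rewrite (cardsD1 e) eU => hk; have := IH (U :\ e) hk.
have -> : T :|: U = e |: (T :|: U :\ e).
  apply/setP => x; rewrite !inE; case: eqP => [->|_] //=; by rewrite eU orbT.
by have /andP[] := h2 (T :|: U :\ e) e; lia.
Qed.

Lemma nullity_mono S T : S \subset T -> (nu S <= nu T)%N.
Proof.
by move=> sST; have /andP[+ _] := nullity_addS S T; rewrite (setUidPr sST).
Qed.

Lemma nullity_diff S T : S \subset T -> (nu T <= nu S + #|T :\: S|)%N.
Proof.
move=> sST; have /andP[_] := nullity_addS S (T :\: S).
by rewrite setDE setUIr setUCr setIT (setUidPr sST).
Qed.

Lemma nullity_D1 T e : e \in T -> (nu T <= (nu (T :\ e)).+1)%N.
Proof.
case: nuP => _ h2 _ eT; have /andP[_] := h2 (T :\ e) e; by rewrite setD1K.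
Qed.

(** The third clause of [nullity], contraposed: a coloop of T is a coloop of every subset of T that
    contains it. *)
Lemma coloop_sub S T e :
  S \subset T -> e \in T -> nu (T :\ e) = nu T -> nu (e |: S) = nu (S :\ e).
Proof.
case: nuP => _ h2 h3 sST eT hc.
have eN : e \notin T :\ e by rewrite !inE eqxx.
have := h3 _ _ _ (setSD _ sST) eN; rewrite (setD1K eT) hc ltnn.
rewrite -[e |: S](_ : e |: (S :\ e) = _); last first.
  by apply/setP => x; rewrite !inE; case: eqP.
have /andP[a _] := h2 (S :\ e) e.
case: ltnP => [_ /(_ isT)//|b _].
by apply/eqP; rewrite eqn_leq a b.
Qed.

(** Contraction of an element that is not a loop. It stays in the ground set, where it now behaves
    as a coloop. *)
Lemma nullity_contract e : nu [set e] = 0%N -> nullity (fun W => nu (e |: W)).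
Proof.
case: nuP => _ h2 h3 he; split; first by rewrite setU0.
  by move=> T f; rewrite setUCA.
move=> S T f sST fT; rewrite ![_ |: (f |: _)]setUCA.
case: (eqVneq f e) => [->|fe].
  by rewrite !setUA !setUid ltnn.
apply: h3; first exact: setUS.
by rewrite !inE negb_or fe.
Qed.

Lemma nullity_lift B : nu B = 0%N -> nullity (fun W => nu (W :|: B)).
Proof.
case: nuP => _ h2 h3 hB; split; first by rewrite set0U.
  by move=> T e; rewrite -setUA.
move=> S T e sST eT; rewrite -![(e |: _) :|: B]setUA.
case: (boolP (e \in B)) => eB.
  have h (X : {set 'I_n}) : e |: (X :|: B) = X :|: B.
    by apply/setUidPr; rewrite sub1set inE eB orbT.
  by rewrite !h ltnn.
apply: h3; first exact: setSU.
by rewrite inE negb_or eT.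
Qed.

Lemma coloop_ex_or_free T :
  (exists2 e, e \in T & nu (T :\ e) = nu T) \/ coloop_free nu T.
Proof.
case: (boolP [exists e in T, nu (T :\ e) == nu T]).
  by move=> /existsP[e /andP[eT /eqP h]]; left; exists e.
rewrite negb_exists => /forallP h; right => e eT.
rewrite ltn_neqAle nullity_mono ?subsetDl // andbT.
by have := h e; rewrite eT.
Qed.

(** If T has a coloop, it goes into W; otherwise any element can be discarded at the cost of one
    unit of nullity. *)
Lemma nullity_basis T :
  exists W : {set 'I_n}, [/\ W \subset T, nu W = 0%N & (#|W| + nu T = #|T|)%N].
Proof.
move: {2}#|T| (leqnn #|T|) => k; elim: k T => [|k IH] T.
  rewrite leqn0 cards_eq0 => /eqP ->; exists set0.
  by rewrite sub0set nullity_set0 addn0.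
move=> hk; case: (coloop_ex_or_free T) => [[e eT he]|cf].
  have [|W [sW W0 hW]] := IH (T :\ e); first by move: hk; rewrite (cardsD1 e) eT.
  have eW : e \notin W by apply/negP => /(subsetP sW); rewrite !inE eqxx.
  exists (e |: W); split.
  - by rewrite subUset sub1set eT (subset_trans sW) // subsetDl.
  - rewrite (coloop_sub (T := T)) //; last exact: subset_trans sW (subsetDl _ _).
    by apply/eqP; rewrite -leqn0 -W0 nullity_mono // subsetDl.
  - by rewrite cardsU1 eW (cardsD1 e T) eT -he -hW addnA.
case: (set_0Vmem T) => [->|[e eT]].
  by exists set0; rewrite sub0set nullity_set0 addn0.
have [|W [sW W0 hW]] := IH (T :\ e); first by move: hk; rewrite (cardsD1 e) eT.
exists W; split => //; first exact: subset_trans sW (subsetDl _ _).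
have := cf e eT; have := nullity_D1 eT.
rewrite (cardsD1 e T) eT; lia.
Qed.

Lemma nullity_indep_card W T :
  W \subset T -> nu W = 0%N -> (#|W| + nu T <= #|T|)%N.
Proof.
move=> sWT W0; have := nullity_diff sWT; rewrite W0 add0n cardsD.
rewrite (setIidPr sWT) => h.
by have := subset_leq_card sWT; lia.
Qed.

(** A basis W of a dependent set T has exactly rho elements: some element of T is outside W, and
    adding it makes W dependent. *)
Lemma nullity_uniform rho :
  (forall W : {set 'I_n}, (nu W == 0%N) = (#|W| <= rho)%N) ->
  forall T : {set 'I_n}, nu T = (#|T| - rho)%N.
Proof.
move=> hr T; have [W [sW W0 hW]] := nullity_basis T.
have := hr W; rewrite W0 eqxx => /esym Wr.
case: (posnP (nu T)) => [T0|Tp].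
  by have := hr T; rewrite T0 eqxx; lia.
have [e eT eW] : exists2 e, e \in T & e \notin W.
  apply/subsetPn; apply/negP => sTW.
  by have := subset_leq_card sTW; lia.
have := hr (e |: W); rewrite cardsU1 eW.
case: eqP => [e0 _|_ /esym/negbT]; last by lia.
have := nullity_indep_card (W := e |: W) (T := T).
by rewrite subUset sub1set eT sW e0 cardsU1 eW => /(_ isT erefl); lia.
Qed.

(** An element e of A outside B would be a coloop of T, as nu T = nu B <= nu (T :\ e), and then a
    coloop of A. *)
Lemma coloop_free_core_uniq S S' T :
  S \subset T -> S' \subset T -> coloop_free nu S -> coloop_free nu S' ->
  nu S = nu T -> nu S' = nu T -> S = S'.
Proof.
suff main : forall A B : {set 'I_n}, A \subset T -> B \subset T -> coloop_free nu A ->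
    nu B = nu T -> A \subset B.
  move=> sS sS' cS cS' hS hS'; apply/eqP; rewrite eqEsubset.
  by apply/andP; split; apply: main.
move=> A B sA sB cA hB; apply/subsetP => e eA; apply/negPn/negP => eB.
have eT := subsetP sA e eA.
have := cA e eA; rewrite -{2}(setD1K eA) (coloop_sub (T := T)) //.
- have -> : A :\ e :\ e = A :\ e by apply/setP => x; rewrite !inE; case: eqP.
  by rewrite ltnn.
- by apply: subset_trans sA; exact: subsetDl.
apply/eqP; rewrite eqn_leq nullity_mono ?subsetDl //= -hB nullity_mono //.
by apply/subsetD1P.
Qed.

End Nullity.

(** * Cohomology of the independence complex *)

Section Boundary.
Variables (n : nat) (R : comRingType).
Implicit Types (S T : {set 'I_n}) (x : 'I_n -> R) (y z : {set 'I_n} -> R).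

Definition ksign (v : 'I_n) S : R :=
  (-1) ^+ #|[set u in S | (u < v)%N]|.

(** Boundary of the Koszul chain with coefficient y S at e_S, on the elements x_v for v in T. For x
    = 1, read through the complements T :\: S, it is a simplicial coboundary: deleting v from S adds
    v to T :\: S. *)
Definition bd x T y S : R :=
  \sum_(v in T :\: S) ksign v S * x v * y (v |: S).

Lemma ksign_sqr v S : ksign v S * ksign v S = 1.
Proof. by rewrite /ksign -exprD addnn -mul2n exprM sqrrN !expr1n. Qed.

Lemma ksignU u v S : u \notin S ->
  ksign v (u |: S) = (-1) ^+ (u < v)%N * ksign v S.
Proof.
move=> uS; rewrite /ksign -exprD; congr (_ ^+ _).
case: ltnP => uv.
  have -> : [set w in u |: S | (w < v)%N] = u |: [set w in S | (w < v)%N].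
    by apply/setP => w; rewrite !inE; case: eqP => [->|].
  by rewrite cardsU1 !inE (negPf uS).
apply: eq_card => w; rewrite !inE; case: eqP => [->|//].
by rewrite (negPf uS) /= ltnNge uv.
Qed.

Lemma ksign_anti u v S : u != v -> u \notin S -> v \notin S ->
  ksign v S * ksign u (v |: S) = - (ksign u S * ksign v (u |: S)).
Proof.
move=> uv uS vS; rewrite !ksignU //.
have := uv; rewrite -(inj_eq val_inj) neq_ltn /= => /orP[] h; rewrite h ltnNge ltnW //=; ring.
Qed.

Lemma ksign_anti2 u v S : u != v -> u \notin S -> v \notin S ->
  ksign u S * ksign v S = - (ksign v (u |: S) * ksign u (v |: S)).
Proof.
move=> uv uS vS; rewrite !ksignU //.
have := uv; rewrite -(inj_eq val_inj) neq_ltn /= => /orP[] h; rewrite h ltnNge ltnW //=; ring.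
Qed.

Lemma bd_bd x T z S : bd x T (bd x T z) S = 0.
Proof.
rewrite /bd.
pose f v u := ksign v S * ksign u (v |: S) * (x v * x u) * z (u |: (v |: S)).
have E : \sum_(v in T :\: S) ksign v S * x v *
    (\sum_(u in T :\: (v |: S)) ksign u (v |: S) * x u * z (u |: (v |: S))) =
  \sum_(v in T :\: S) \sum_(u in T :\: S | u != v) f v u.
  apply: eq_bigr => v _; rewrite mulr_sumr; apply: eq_big.
    by move=> u; rewrite !inE; case: eqP; rewrite ?andbF ?andbT.
  by move=> u _; rewrite /f; ring.
rewrite E {E}.
have E : \sum_(v in T :\: S) \sum_(u in T :\: S | u != v) f v u =
  \sum_(v in T :\: S) \sum_(u in T :\: S | (u < v)%N) f v u +
  \sum_(v in T :\: S) \sum_(u in T :\: S | (v < u)%N) f v u.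
  rewrite -big_split; apply: eq_bigr => v _ /=.
  rewrite (bigID (fun u : 'I_n => (u < v)%N)) /=; congr (_ + _); apply: eq_bigl => u.
    by rewrite -(inj_eq val_inj) /=; case: ltngtP; rewrite ?andbF ?andbT.
  by rewrite -(inj_eq val_inj) /=; case: ltngtP; rewrite ?andbF ?andbT.
rewrite E {E} [X in _ + X](exchange_big_dep (mem (T :\: S))) /=; last by move=> i j _ /andP[].
rewrite -big_split big1 //= => v vS.
rewrite [X in _ + X](eq_bigl (fun u => (u \in T :\: S) && (u < v)%N)); last first.
  by move=> u; rewrite vS.
rewrite -big_split big1 //= => u /andP[uS uv].
move: vS uS; rewrite !inE => /andP[vS _] /andP[uS _].
rewrite /f setUCA ksign_anti //; first by rewrite [x u * _]mulrC; ring.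
by rewrite -(inj_eq val_inj) /= ltn_eqF.
Qed.

Lemma bdB x T y z S : bd x T (fun U => y U - z U) S = bd x T y S - bd x T z S.
Proof. by rewrite /bd -sumrB; apply: eq_bigr => v _; rewrite mulrBr. Qed.

Lemma bdD x T y z S : bd x T (fun U => y U + z U) S = bd x T y S + bd x T z S.
Proof. by rewrite /bd -big_split; apply: eq_bigr => v _; rewrite mulrDr. Qed.

End Boundary.

Section Acyclic.
Variables (n : nat) (F : fieldType).
Implicit Types (S T : {set 'I_n}) (y z : {set 'I_n} -> F).

Local Notation bd1 := (@bd n F (fun _ => 1)).

(** With a coloop e the independence complex on T is a cone with apex e, and z is the cone
    contraction of y. At sets without e the equation is immediate; at a set S containing e it comes
    from evaluating the boundary of y - bd z at S :\ e, where only the term for e survives. *)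
Lemma acyclic_cone (nu : {set 'I_n} -> nat) T e (i : nat) y :
  nullity nu -> e \in T -> nu (T :\ e) = nu T ->
  (forall S, S \subset T -> #|S|.+1 = i -> nu (T :\: S) = 0%N -> bd1 T y S = 0) ->
  exists z, forall S, S \subset T -> #|S| = i -> nu (T :\: S) = 0%N ->
    y S = bd1 T z S.
Proof.
move=> nuP eT he cyc.
pose z S := if e \in S then ksign F e (S :\ e) * y (S :\ e) else 0.
have zE S : e \notin S -> bd1 T z S = y S.
  move=> eS; rewrite /bd (bigD1 e) ?inE ?eS ?eT //= big1 ?addr0.
    by rewrite /z setU11 setU1K // mulr1 mulrA ksign_sqr mul1r.
  move=> v /andP[]; rewrite !inE => /andP[vS vT] ve.
  by rewrite /z !inE eq_sym (negPf ve) (negPf eS) mulr0.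
exists z => S sST Si S0.
case: (boolP (e \in S)) => eS; last by rewrite zE.
apply/eqP; rewrite -subr_eq0 -[S in _ S - _](setD1K eS) -[S in bd _ _ _ S](setD1K eS).
have sS' : S :\ e \subset T by exact: subset_trans (subsetDl _ _) sST.
have eS' : e \notin S :\ e by rewrite !inE eqxx.
have TS : T :\: (S :\ e) = e |: (T :\: S).
  apply/setP => v; rewrite !inE; case: eqP => [->|] //=; by rewrite eT eS.
have nu0 : nu (T :\: (S :\ e)) = 0%N.
  rewrite TS (coloop_sub nuP (T := T)) ?subsetDl //.
  by apply/eqP; rewrite -leqn0 -S0 (nullity_mono nuP) ?subsetDl.
have := bdB (fun _ => 1) T y (bd1 T z) (S :\ e).
rewrite bd_bd cyc // ?subr0; last by rewrite -Si (cardsD1 e S) eS.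
rewrite {1}/bd (bigD1 e) ?inE ?eqxx ?eT //= big1 ?addr0.
  move=> /(congr1 (fun t => ksign F e (S :\ e) * t)).
  by rewrite mulr0 mulr1 mulrA ksign_sqr mul1r => ->.
move=> v /andP[]; rewrite !inE => /andP[vS vT] ve.
rewrite zE ?subrr ?mulr0 // !inE eqxx /= orbF eq_sym; exact: ve.
Qed.

(* Removing an element e splits a cochain into its values on the sets that
   contain e (ground set T :\ e) and on those that do not (nu contracted at e). *)
Lemma acyclic (nu : {set 'I_n} -> nat) T (i : nat) y :
  nullity nu ->
  i <> nu T \/ (exists2 e, e \in T & nu (T :\ e) = nu T) ->
  (forall S, S \subset T -> #|S|.+1 = i -> nu (T :\: S) = 0%N -> bd1 T y S = 0) ->
  exists z, forall S, S \subset T -> #|S| = i -> nu (T :\: S) = 0%N ->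
    y S = bd1 T z S.
Proof.
move: {2}#|T| (erefl #|T|) => t; elim: t nu T i y => [|t IH] nu T i y Tt nuP.
  move/eqP: Tt; rewrite cards_eq0 => /eqP -> [iT|[e]]; last by rewrite inE.
  move=> _; exists y => S; rewrite subset0 => /eqP -> S0.
  by case: iT; rewrite (nullity_set0 nuP) -S0 cards0.
case=> [iT|[e eT he]]; last exact: acyclic_cone eT he.
case: (coloop_ex_or_free nuP T) => [[e eT he]|cf]; first exact: acyclic_cone eT he.
case: (ltngtP i (nu T)) => // {iT} iT cyc.
  exists y => S sS Si S0.
  have := nullity_diff nuP (subsetDl T S).
  have -> : T :\: (T :\: S) = S by rewrite setDDr setDv set0U; apply/setIidPr.
  by rewrite S0 Si; lia.
have [e eT] : exists e, e \in T by apply/set0Pn; rewrite -card_gt0 Tt.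
have nuT' : nu (T :\ e) = (nu T).-1.
  by have := cf e eT; have := nullity_D1 nuP eT; lia.
have T't : #|T :\ e| = t by move: Tt; rewrite (cardsD1 e) eT => -[].
have eN (S : {set 'I_n}) : S \subset T :\ e -> e \notin S.
  by move=> sS; apply/negP => /(subsetP sS); rewrite !inE eqxx.
have DU (S : {set 'I_n}) : T :\: (e |: S) = (T :\ e) :\: S.
  by rewrite setDDl.
(* The values at sets containing e form a cycle on T :\ e in size i - 1, for the same nu; as nu (T
   :\ e) = nu T - 1, this is again not the excluded size. *)
pose y1 S := ksign F e S * y (e |: S).
have [||z1 z1P] := IH nu (T :\ e) i.-1 y1 T't nuP.
- by left; have := cf e eT; move: nuT' iT; clear; lia.
- move=> S sS Si S0.
  have eS := eN _ sS.
  have := cyc (e |: S); rewrite DU S0 cardsU1 eS.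
  rewrite subUset sub1set eT (subset_trans sS) ?subsetDl //.
  move=> /(_ isT) /(_ _ erefl); have -> : (1 + #|S|).+1 = i by lia.
  move=> /(_ erefl) h.
  apply: (etrans (y := - (ksign F e S * bd1 T y (e |: S)))); last by rewrite h mulr0 oppr0.
  rewrite /bd DU mulr_sumr -sumrN; apply: eq_bigr => v.
  rewrite !inE => /andP[vS /andP[ve vT]].
  rewrite /y1 !mulr1 setUCA !mulrA -mulNr; congr (_ * _).
  by rewrite ksign_anti // eq_sym.
pose z0 S := if e \in S then - (ksign F e (S :\ e) * z1 (S :\ e)) else 0.
have z0E S : S \subset T :\ e -> #|S|.+1 = i -> nu (T :\: (e |: S)) = 0%N ->
    bd1 T z0 (e |: S) = y (e |: S).
  move=> sS Si; rewrite DU => S0; have eS := eN _ sS.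
  have := z1P _ sS; rewrite -Si S0 => /(_ erefl erefl).
  move/(congr1 (fun t => ksign F e S * t)); rewrite /y1 mulrA ksign_sqr mul1r => ->.
  rewrite /bd mulr_sumr DU; apply: eq_bigr => v; rewrite !inE.
  move=> /andP[vS /andP[ve vT]].
  have -> : z0 (v |: (e |: S)) = - (ksign F e (v |: S) * z1 (v |: S)).
    have h1 : e \notin v |: S by rewrite !inE negb_or eq_sym ve.
    by rewrite /z0 setUCA setU11 setU1K.
  rewrite !mulr1 mulrN mulrA -mulNr mulrA; congr (_ * _).
  by rewrite [RHS]ksign_anti2 ?mulNr // eq_sym.
(* The correction by z0 kills the relevant values at the sets containing e. *)
pose y2 S := y S - bd1 T z0 S.
have y2e S : S \subset T -> e \in S -> #|S| = i -> nu (T :\: S) = 0%N -> y2 S = 0.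
  move=> sS eS Si S0; rewrite /y2 -(setD1K eS) z0E ?subrr //.
  - exact: setSD.
  - by rewrite -Si (cardsD1 e S) eS.
  - by rewrite setD1K.
(* If e is a loop, every set with independent complement contains e, and z0 suffices. Otherwise the
   remaining values live on T :\ e with e contracted. *)
case: (posnP (nu [set e])) => [e0|e1]; last first.
  exists z0 => S sS Si S0; apply/eqP; rewrite -subr_eq0; apply/eqP; apply: y2e => //.
  apply/negPn/negP => eS; move: e1; rewrite ltnNge => /negP; apply.
  by rewrite -S0 (nullity_mono nuP) // sub1set !inE eS eT.
have eD S : S \subset T :\ e -> T :\: S = e |: (T :\ e :\: S).
  move=> sS; have eS := eN _ sS; apply/setP => v; rewrite !inE.
  by case: eqP => [->|//]; rewrite eS eT.
have [||z2 z2P] := IH _ (T :\ e) i y2 T't (nullity_contract nuP e0).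
- by left; rewrite setD1K //; lia.
- move=> S sS Si; rewrite -eD // => S0; have eS := eN _ sS.
  have sST : S \subset T by exact: subset_trans sS (subsetDl _ _).
  have := bdB (fun _ => 1) T y (bd1 T z0) S; rewrite bd_bd cyc // subr0.
  rewrite {1}/bd (bigD1 e) ?inE ?eS ?eT //= -/(y2 _) y2e ?setU11 //.
  + rewrite mulr0 add0r => h; rewrite -[RHS]h; apply: eq_bigl => v; rewrite !inE.
    by case: (v \in S); case: (v == e); case: (v \in T).
  + by rewrite subUset sub1set eT.
  + by rewrite cardsU1 eS.
  + by apply/eqP; rewrite -leqn0 -S0 (nullity_mono nuP) // setDS // subsetUr.
exists (fun S => z0 S + (if e \in S then 0 else z2 S)) => S sS Si S0.
rewrite bdD; apply/eqP; rewrite addrC -subr_eq -/(y2 S); apply/eqP.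
case: (boolP (e \in S)) => eS.
  rewrite y2e // /bd big1 // => v _.
  by rewrite inE eS orbT mulr0.
have sS' : S \subset T :\ e by apply/subsetD1P.
rewrite z2P //; last by rewrite -eD.
rewrite /bd [in RHS](bigD1 e) ?inE ?eS ?eT //= eqxx mulr0 add0r.
apply: eq_big => v; rewrite !inE; first by case: (v \in S); case: (v == e); case: (v \in T).
by move=> /and3P[vS ve vT]; rewrite eq_sym (negPf ve) (negPf eS).
Qed.

End Acyclic.

(** * Koszul homology of Stanley-Reisner rings *)

Lemma choice_in (A B : Type) (P : A -> Prop) (Q : A -> B -> Prop) (b0 : B) :
  (forall a, P a -> exists b, Q a b) ->
  exists f, forall a, P a -> Q a (f a).
Proof.
move=> h; have h' a : exists b, P a -> Q a b.
  case: (classic (P a)) => [/h[b ?]|?]; [by exists b | by exists b0].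
exists (fun a => proj1_sig (constructive_indefinite_description _ (h' a))) => a.
exact: (proj2_sig (constructive_indefinite_description _ (h' a))).
Qed.

Section Monomials.
Variable n : nat.
Implicit Types (S T U : {set 'I_n}) (g : 'X_{1..n}).

Definition mnm_supp g : {set 'I_n} := [set i | (0 < g i)%N].
Definition mnm_set S : 'X_{1..n} := [multinom (i \in S : nat) | i < n].

Lemma mnm_setE S i : mnm_set S i = (i \in S). Proof. exact: mnmE. Qed.

Lemma mnm_set0 : mnm_set set0 = 0%MM.
Proof. by apply/mnmP => i; rewrite mnm_setE inE mnm0E. Qed.

Lemma mnm_set_le S g : (mnm_set S <= g)%MM = (S \subset mnm_supp g).
Proof.
apply/mnm_lepP/subsetP => h i; have := h i; rewrite mnm_setE inE.
  by case: (i \in S).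
by case: (i \in S) => // ->.
Qed.

Lemma mnm_supp_set S : mnm_supp (mnm_set S) = S.
Proof. by apply/setP => i; rewrite inE mnm_setE; case: (i \in S). Qed.

Lemma mdeg_set S : mdeg (mnm_set S) = #|S|.
Proof.
rewrite mdegE -sum1_card [RHS]big_mkcond /=; apply: eq_bigr => i _.
by rewrite mnm_setE; case: (i \in S).
Qed.

Lemma mnm_setK S g : S \subset mnm_supp g -> (g - mnm_set S + mnm_set S = g)%MM.
Proof. by rewrite -mnm_set_le => /submK. Qed.

Lemma mnm_setU S U : [disjoint S & U] ->
  mnm_set (S :|: U) = (mnm_set S + mnm_set U)%MM.
Proof.
move=> dSU; apply/mnmP => i; rewrite mnmDE !mnm_setE inE.
by have := disjointFr dSU (x := i); case: (i \in S) => // ->.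
Qed.

Lemma mnm_suppD g k : mnm_supp (g + k)%MM = mnm_supp g :|: mnm_supp k.
Proof. by apply/setP => i; rewrite !inE mnmDE addn_gt0. Qed.

Lemma prod_X_set (F : comRingType) S :
  \prod_(i in S) 'X_i = 'X_[mnm_set S] :> {mpoly F[n]}.
Proof.
rewrite mpolyXE_id big_mkcond /=; apply: eq_bigr => i _.
by rewrite mnm_setE; case: (i \in S); rewrite ?expr0 ?expr1.
Qed.

Lemma mcoeffXM (R : comRingType) g k (f : {mpoly R[n]}) :
  ('X_[g] * f)@_k = if (g <= k)%MM then f@_(k - g) else 0.
Proof.
case: ifP => h.
  by rewrite -{1}(submK h) addmC mulrC mcoeffMX.
apply: memN_msupp_eq0; rewrite mulrC (perm_mem (msuppMX _ _)).
by apply/negP => /mapP[m _ E]; move: h; rewrite E lem_addr.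
Qed.

Lemma mcoeff_setXM (R : comRingType) S U g (f : {mpoly R[n]}) :
  [disjoint U & S] -> S \subset mnm_supp g ->
  ('X_[mnm_set U] * f)@_(g - mnm_set S) =
  if U \subset mnm_supp g then f@_(g - mnm_set (U :|: S)) else 0.
Proof.
move=> dUS sS; rewrite mcoeffXM mnm_setU // addmC -submDA; congr (if _ then _ else _).
rewrite -mnm_set_le; apply/mnm_lepP/mnm_lepP => h i; have := h i; rewrite mnmBE !mnm_setE.
  by move=> h1; apply: leq_trans h1 (leq_subr _ _).
have := disjointFr dUS (x := i); case: (i \in U) => // /(_ isT) -> /=.
by rewrite subn0.
Qed.

Lemma mcoeff_assemble (R : comNzRingType) (G : seq 'X_{1..n}) S (c : 'X_{1..n} -> R) g :
  uniq G -> S \subset mnm_supp g ->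
  (\sum_(k <- G) (if S \subset mnm_supp k then c k else 0) *: 'X_[k - mnm_set S])@_
     (g - mnm_set S) = if g \in G then c g else 0.
Proof.
move=> uG sg; rewrite raddf_sum /=.
have E k : (if S \subset mnm_supp k then c k else 0) *
    ('X_[k - mnm_set S] : {mpoly R[n]})@_(g - mnm_set S) =
    if k == g then c g else 0.
  rewrite mcoeffX; case: (eqVneq k g) => [->|kg]; first by rewrite sg eqxx mulr1.
  case: ifP => [sk|_]; last by rewrite mul0r.
  case: eqP => [/(congr1 (fun m => m + mnm_set S)%MM)|_]; last by rewrite mulr0.
  by rewrite !mnm_setK // => /eqP; rewrite (negPf kg).
under eq_bigr do rewrite mcoeffZ E.
case: ifP => gG; last first.
  rewrite big1_seq // => k /andP[_ kG]; case: eqP => // kg.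
  by move: kG; rewrite kg gG.
by rewrite (bigD1_seq g) //= eqxx big1 ?addr0 // => k /negPf ->.
Qed.

End Monomials.

Definition in_sr (F : fieldType) n (nu : {set 'I_n} -> nat) (f : {mpoly F[n]}) :=
  forall g, g \in msupp f -> (0 < nu (mnm_supp g))%N.

Section Koszul.
Variables (n : nat) (F : fieldType).
Implicit Types (S T U J : {set 'I_n}) (y z : {set 'I_n} -> {mpoly F[n]}).

Definition kdiff J y S : {mpoly F[n]} := bd (fun v => 'X_v) J y S.

(** In multidegree g the coefficient of e_S is a scalar times x^g / x_S, so the variables act there
    as the scalar 1, and only those in the support of g take part. *)
Lemma mcoeff_kdiff J y S g : S \subset mnm_supp g ->
  (kdiff J y S)@_(g - mnm_set S) =
  \sum_(v in (J :&: mnm_supp g) :\: S)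
     ksign F v S * 1 * (y (v |: S))@_(g - mnm_set (v |: S)).
Proof.
move=> sS; rewrite /kdiff /bd raddf_sum /= (bigID (fun v => v \in mnm_supp g)) /=.
rewrite [X in _ + X]big1 ?addr0; last first.
  move=> v /andP[]; rewrite in_setD => /andP[vS vJ] vg.
  have -> : ksign {mpoly F[n]} v S = (ksign F v S)%:MP by rewrite rmorphXn rmorphN1.
  rewrite -mulrA mcoeffCM.
  have -> : 'X_v = 'X_[mnm_set [set v]] :> {mpoly F[n]}.
    by congr 'X_[_]; apply/mnmP => i; rewrite mnm_setE inE mnm1E eq_sym.
  rewrite mcoeff_setXM // ?sub1set ?(negPf vg) ?mulr0 //.
  by rewrite disjoints1.
apply: eq_big => [v|v /andP[]]; rewrite !in_setD ?in_setI ?andbA // => /andP[vS vJ] vg.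
have -> : ksign {mpoly F[n]} v S = (ksign F v S)%:MP by rewrite rmorphXn rmorphN1.
rewrite -mulrA mcoeffCM mulr1; congr (_ * _).
have -> : 'X_v = 'X_[mnm_set [set v]] :> {mpoly F[n]}.
  by congr 'X_[_]; apply/mnmP => i; rewrite mnm_setE inE mnm1E eq_sym.
by rewrite mcoeff_setXM ?sub1set ?vg // disjoints1.
Qed.

Definition kground J (g : 'X_{1..n}) := J :&: mnm_supp g.
(** The variables that stay in x^g / x_S for every subset S of [kground]. *)
Definition kbase J (g : 'X_{1..n}) :=
  [set v in mnm_supp g | (v \notin J) || (1 < g v)%N].

Lemma mnm_supp_kbase J g S : S \subset kground J g ->
  mnm_supp (g - mnm_set S)%MM = (kground J g :\: S) :|: kbase J g.
Proof.
move=> /subsetP sS; apply/setP => v; have := sS v; rewrite !inE mnmBE mnm_setE.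
case: (v \in S) => [/(_ isT)/andP[-> h]|_] /=.
  by rewrite subn_gt0 h.
by rewrite subn0; case: (v \in J); rewrite ?andbT //=; case: (g v) => [|[]].
Qed.

(* Multidegree by multidegree the complex is that of [acyclic], for the nullity
   W |-> nu (W :|: kbase J g). *)
Lemma koszul_acyclic (nu : {set 'I_n} -> nat) J (i : nat)
    (Q : 'X_{1..n} -> Prop) y :
  nullity nu ->
  (forall g, Q g -> nu (kbase J g) = 0%N ->
     i <> nu (kground J g :|: kbase J g) \/
     exists2 e, e \in kground J g &
       nu ((kground J g :\ e) :|: kbase J g) = nu (kground J g :|: kbase J g)) ->
  (forall S g, S \subset J -> #|S| = i -> g \in msupp (y S) ->
     Q (g + mnm_set S)%MM) ->
  (forall S, S \subset J -> #|S|.+1 = i -> in_sr nu (kdiff J y S)) ->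
  exists z,
    (forall S g, g \in msupp (z S) -> Q (g + mnm_set S)%MM) /\
    (forall S, S \subset J -> #|S| = i -> in_sr nu (y S - kdiff J z S)).
Proof.
move=> nuP hQ hy cyc.
pose yc g S := (y S)@_(g - mnm_set S).
pose lifts g (w : {set 'I_n} -> F) := forall S, S \subset kground J g -> #|S| = i ->
      nu ((kground J g :\: S) :|: kbase J g) = 0%N ->
      yc g S = bd (fun _ => 1) (kground J g) w S.
have [zc zcP] : exists zc : 'X_{1..n} -> {set 'I_n} -> F, forall g, Q g -> lifts g (zc g).
  apply: (@choice_in _ _ Q lifts (fun _ => 0)) => g Qg; rewrite /lifts.
  (* If the base is dependent, all the monomials concerned lie in the ideal and there is nothing to
     lift. *)
  case: (posnP (nu (kbase J g))) => [B0|Bp]; last first.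
    exists (fun _ => 0) => S _ _ S0; move: Bp; rewrite ltnNge => /negP[].
    by rewrite -S0 nullity_mono // subsetUr.
  apply: (@acyclic n F (fun W => nu (W :|: kbase J g)) (kground J g) i (yc g)
    (nullity_lift nuP B0) (hQ g Qg B0)) => S sS Si S0.
  have sJ : S \subset J by apply: subset_trans sS (subsetIl _ _).
  have sg : S \subset mnm_supp g by apply: subset_trans sS (subsetIr _ _).
  rewrite /bd -mcoeff_kdiff //; apply/eqP; rewrite mcoeff_eq0; apply/negP.
  by move=> /(cyc S sJ Si); rewrite (mnm_supp_kbase sS) S0.
(* Only the finitely many multidegrees that occur in y are lifted, so that z has polynomial
   values. *)
pose G := undup (flatten [seq [seq (g + mnm_set A)%MM | g <- msupp (y A)]
   | A : {set 'I_n} <- enum [set A : {set 'I_n} | (A \subset J) && (#|A| == i)]]).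
have GP g S : S \subset J -> #|S| = i -> g \in msupp (y S) -> (g + mnm_set S)%MM \in G.
  move=> sJ Si gS; rewrite mem_undup; apply/flattenP.
  exists [seq (g + mnm_set S)%MM | g <- msupp (y S)]; last exact: map_f.
  by apply: map_f; rewrite mem_enum inE sJ Si eqxx.
have GQ g : g \in G -> Q g.
  rewrite mem_undup => /flattenP[s /mapP[S]].
  rewrite mem_enum inE => /andP[sJ /eqP Si] -> /mapP[k kS ->]; exact: hy.
pose z S := \sum_(g <- G) (if S \subset mnm_supp g then zc g S else 0) *: 'X_[g - mnm_set S].
have zE S g : S \subset mnm_supp g ->
    (z S)@_(g - mnm_set S) = if g \in G then zc g S else 0.
  by move=> sg; rewrite /z (mcoeff_assemble (fun k => zc k S)) ?undup_uniq.
exists z; split.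
  move=> S g; rewrite mcoeff_msupp /z raddf_sum /= => h.
  have [k kG] : exists2 k, k \in G & ((if S \subset mnm_supp k then zc k S else 0) *:
      ('X_[k - mnm_set S] : {mpoly F[n]}))@_g != 0.
    apply/hasP; apply: contraNT h => /hasPn h; rewrite big1_seq // => k /andP[_ /h].
    by rewrite negbK => /eqP.
  rewrite mcoeffZ mcoeffX; case: ifP => [sk|_]; last by rewrite mul0r eqxx.
  case: (eqVneq (k - mnm_set S)%MM g) => [<- _|_]; last by rewrite mulr0 eqxx.
  by rewrite mnm_setK //; apply: GQ.
move=> S sJ Si g; rewrite mcoeff_msupp lt0n; apply: contraNN => /eqP g0.
pose k := (g + mnm_set S)%MM.
have kS : S \subset mnm_supp k by rewrite mnm_suppD mnm_supp_set subsetUr.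
have gE : g = (k - mnm_set S)%MM by rewrite addmK.
have kJ : S \subset kground J k by rewrite subsetI sJ.
rewrite gE mcoeffB mcoeff_kdiff // -/(yc k S).
have E : \sum_(v in J :&: mnm_supp k :\: S) ksign F v S * 1 *
    (z (v |: S))@_(k - mnm_set (v |: S)) =
    if k \in G then bd (fun _ => 1) (kground J k) (zc k) S else 0.
  case: ifP => kG.
    apply: eq_bigr => v; rewrite !inE => /and3P[vS vJ vk].
    by rewrite zE ?kG // subUset kS sub1set inE vk.
  rewrite big1 // => v; rewrite !inE => /and3P[vS vJ vk].
  by rewrite zE ?kG ?mulr0 // subUset kS sub1set inE vk.
apply/eqP; rewrite E; case: ifP => kG.
  rewrite zcP ?subrr //; first exact: GQ.
  by rewrite -(mnm_supp_kbase kJ) -gE.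
rewrite subr0 /yc -gE; apply/eqP; rewrite mcoeff_eq0; apply/negP => /(GP _ _ sJ Si).
by rewrite -/k kG.
Qed.

End Koszul.

(** * Degrees in a minimal resolution *)

Section KoszulRows.
Variables (n : nat) (F : fieldType).
Implicit Types (S T J : {set 'I_n}).
Local Notation R := {mpoly F[n]}.

Definition krow b J (Y : {set 'I_n} -> 'rV[R]_b) S : 'rV[R]_b :=
  \sum_(v in J :\: S) (ksign R v S * 'X_v) *: Y (v |: S).

Lemma krowE b J (Y : {set 'I_n} -> 'rV[R]_b) S j :
  krow J Y S 0 j = kdiff J (fun U => Y U 0 j) S.
Proof. by rewrite summxE; apply: eq_bigr => v _; rewrite mxE. Qed.

Lemma krow_ext b J (Y Z : {set 'I_n} -> 'rV[R]_b) S :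
  (forall v, v \in J -> v \notin S -> Y (v |: S) = Z (v |: S)) ->
  krow J Y S = krow J Z S.
Proof.
by move=> h; apply: eq_bigr => v; rewrite in_setD => /andP[vS vJ]; rewrite h.
Qed.

Lemma krowM b c J (Y : {set 'I_n} -> 'rV[R]_b) (D : 'M[R]_(b, c)) S :
  krow J Y S *m D = krow J (fun U => Y U *m D) S.
Proof. by rewrite mulmx_suml; apply: eq_bigr => v _; rewrite scalemxAl. Qed.

Lemma krowD b J (Y Z : {set 'I_n} -> 'rV[R]_b) S :
  krow J (fun U => Y U + Z U) S = krow J Y S + krow J Z S.
Proof. by rewrite -big_split; apply: eq_bigr => v _; rewrite scalerDr. Qed.

Lemma krowB b J (Y Z : {set 'I_n} -> 'rV[R]_b) S :
  krow J (fun U => Y U - Z U) S = krow J Y S - krow J Z S.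
Proof. by rewrite -sumrB; apply: eq_bigr => v _; rewrite scalerBr. Qed.

Lemma krow_krow b J (Y : {set 'I_n} -> 'rV[R]_b) S : krow J (krow J Y) S = 0.
Proof.
apply/rowP => j; rewrite krowE mxE -[RHS](bd_bd (fun v => 'X_v) J (fun U => Y U 0 j) S).
by apply: eq_bigr => v _; rewrite krowE.
Qed.

(** The case of the zero ideal in [koszul_acyclic], entry by entry. For the zero nullity every
    element of the ground set is a coloop, so the only obstruction is i = 0 with an empty ground
    set, which the first hypothesis excludes. *)
Lemma krow_exact b J i (Q : 'I_b -> 'X_{1..n} -> Prop)
    (Y : {set 'I_n} -> 'rV[R]_b) :
  (forall j g, Q j g -> i = 0%N -> exists v, v \in kground J g) ->
  (forall S j g, S \subset J -> #|S| = i -> g \in msupp (Y S 0 j) ->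
     Q j (g + mnm_set S)%MM) ->
  (forall S, S \subset J -> #|S|.+1 = i -> krow J Y S = 0) ->
  exists Z : {set 'I_n} -> 'rV[R]_b,
    (forall S j g, g \in msupp (Z S 0 j) -> Q j (g + mnm_set S)%MM) /\
    (forall S, S \subset J -> #|S| = i -> Y S = krow J Z S).
Proof.
move=> hQ hY cyc.
have null0 : nullity (fun _ : {set 'I_n} => 0%N) by split.
have in0 (f : R) : in_sr (fun _ => 0%N) f -> f = 0.
  by move=> h; apply: msuppnil0; case fE: (msupp f) => [//|g s]; have := h g; rewrite fE mem_head => /(_ isT).
have h j : exists z, (forall S g, g \in msupp (z S) -> Q j (g + mnm_set S)%MM) /\
    (forall S, S \subset J -> #|S| = i -> Y S 0 j = kdiff J z S).
  have [|||z [z1 z2]] := @koszul_acyclic n F _ J i (Q j) (fun S => Y S 0 j) null0.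
  - move=> g Qg _; case: (posnP i) => [i0|ip]; last by left; lia.
    by right; have [v vg] := hQ j g Qg i0; exists v.
  - by move=> S g; exact: hY.
  - move=> S sJ Si g; rewrite -krowE cyc // mxE msupp0.
    by [].
  exists z; split => // S sJ Si; apply/eqP; rewrite -subr_eq0; apply/eqP/in0.
  exact: z2.
have [z zP] := fin_all_exists h.
exists (fun S => \row_j z j S); split.
  by move=> S j g; rewrite mxE; exact: (zP j).1.
move=> S sJ Si; apply/rowP => j; rewrite krowE (zP j).2 //.
by apply: eq_bigr => v _; rewrite mxE.
Qed.

End KoszulRows.

(** * Zigzags between a resolution and the Koszul complex *)

Section StanleyReisner.
Variables (n : nat) (F : fieldType) (nu : {set 'I_n} -> nat).
Variable face : {set 'I_n} -> bool.
Hypothesis nuP : nullity nu.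
Hypothesis faceE : forall S, face S = (nu S == 0%N).

Lemma sr_idealP (f : {mpoly F[n]}) : sr_ideal face f <-> in_sr nu f.
Proof.
split.
  move=> [c ->] g /msupp_sum_le /flattenP[s /mapP[S]].
  rewrite mem_filter faceE -lt0n => /andP[Sp _] -> .
  rewrite prod_X_set (perm_mem (msuppMX _ _)) => /mapP[k _ ->].
  by apply: leq_trans Sp _; apply: nullity_mono => //; rewrite mnm_suppD mnm_supp_set subsetUl.
move=> h; exists (fun S => \sum_(g <- msupp f | mnm_supp g == S) f@_g *: 'X_[g - mnm_set S]).
rewrite {1}[f]mpolyE.
under [RHS]eq_bigr do rewrite mulr_suml.
rewrite (exchange_big_dep (fun g => true)) //= !big_seq; apply: eq_bigr => g gf.
rewrite (big_pred1 (mnm_supp g)) /=.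
  rewrite prod_X_set -scalerAl -mpolyXD mnm_setK //.
move=> S; rewrite faceE [_ == S]eq_sym; case: (eqVneq S (mnm_supp g)) => [->|nS].
  by rewrite andbT -lt0n h //= eqxx.
by rewrite andbF /= (negPf nS).
Qed.

Variable E : free_seq F n.
Hypothesis Egr : graded_maps E.
Hypothesis Eex : exact_over (sr_ideal face) E.
Hypothesis Emin : minimal_maps E.

Local Notation tw p j := ((twists E p)`_j).
Local Notation row p := 'rV[{mpoly F[n]}]_(size (twists E p)).

Lemma diffK p (w : row p.+2) : w *m diff E p.+1 *m diff E p = 0.
Proof. by apply/Eex.2; exists w. Qed.

Lemma in_sr_im (f : {mpoly F[n]}) :
  in_sr nu f <-> exists w : row 1, (f%:M : 'rV_1) = w *m diff E 0.
Proof. by rewrite -sr_idealP; exact: Eex.1. Qed.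

Definition hom_degree (j : int) p (a : 'I_(size (twists E p))) (g : 'X_{1..n}) : Prop :=
  (mdeg g)%:Z + tw p a = j.

(* For p = 0 this is the vanishing of the Koszul homology of the quotient ring in
   homological degree i and degree j; a zigzag through the double complex
   resolution (x) Koszul transports it to p = i, where it forbids a generator of
   degree j in the i-th module of a minimal resolution. *)
Definition tor_vanishes (i : nat) (j : int) (p : nat) : Prop :=
  forall Y : {set 'I_n} -> row p,
  (forall (S : {set 'I_n}) (a : 'I_(size (twists E p))) g, (#|S| + p)%N = i ->
     g \in msupp (Y S 0 a) -> hom_degree j a (g + mnm_set S)%MM) ->
  (forall S : {set 'I_n}, (#|S|.+1 + p)%N = i ->
     exists V : row p.+1, krow setT Y S = V *m diff E p) ->
  exists (U : {set 'I_n} -> row p.+1) (W : {set 'I_n} -> row p),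
    forall S : {set 'I_n}, (#|S| + p)%N = i ->
      Y S = U S *m diff E p + krow setT W S.

(** In a multidegree of total degree j, a variable of exponent at least 2 is in both the ground set
    and the base, hence acts as a coloop. In a squarefree one, the support has a coloop or is
    coloop-free with j elements, and then its nullity is not i by assumption. *)
Lemma tor_vanishes0 i j :
  ~ (exists T : {set 'I_n}, [/\ coloop_free nu T, nu T = i & #|T|%:Z = j]) ->
  tor_vanishes i j 0.
Proof.
move=> hno Y Yhom cyc.
have row0 (y : row 0) : (y 0 0)%:M = y :> 'rV_1.
  by apply/rowP => k; rewrite !mxE !ord1 eqxx.
have [|||z [_ zP]] := @koszul_acyclic n F nu setT i
    (fun g => (mdeg g)%:Z = j) (fun S => Y S 0 0) nuP.
- move=> g gj _; rewrite /kground setTI.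
  case: (set_0Vmem (kbase setT g)) => [B0|[e]].
    rewrite B0 !setU0.
    have gE : g = mnm_set (mnm_supp g).
      apply/mnmP => v; rewrite mnm_setE inE.
      by move/setP/(_ v): B0; rewrite !inE; case: (g v) => [|[]].
    case: (coloop_ex_or_free nuP (mnm_supp g)) => [[e eg he]|cf].
      by right; exists e; rewrite ?setU0.
    by left => iE; apply: hno; exists (mnm_supp g); rewrite -mdeg_set -gE.
  rewrite inE => /andP[eg eB]; right; exists e => //.
  rewrite inE /= in eB; rewrite inE in eg; congr nu; apply/setP => v; rewrite !inE /=.
  by case: (eqVneq v e) => //= ->; rewrite eg eB.
- move=> S g _ Si gS; have := Yhom S 0 g; rewrite addn0 => /(_ Si gS).
  by rewrite /hom_degree /= addr0.
- move=> S _ Si; have [|V hV] := cyc S; first by rewrite addn0.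
  by apply/in_sr_im; exists V; rewrite -krowE row0.
have hU (S : {set 'I_n}) : exists u : row 1, #|S| = i ->
    Y S = u *m diff E 0 + krow setT (fun U => (z U)%:M) S.
  case: (eqVneq #|S| i) => [Si|Si]; last by exists 0 => /eqP; rewrite (negPf Si).
  have /in_sr_im[u hu] := zP S (subsetT _) Si.
  exists u => _; rewrite -hu; apply/rowP => k; rewrite ord1 mxE krowE !mxE eqxx mulr1n.
  rewrite [X in _ + X](_ : _ = kdiff setT z S); first by rewrite subrK.
  by rewrite /kdiff /bd; apply: eq_bigr => v _; rewrite mxE eqxx mulr1n.
have [U UP] := fin_all_exists hU.
exists U, (fun S => (z S)%:M) => S; rewrite addn0; exact: UP.
Qed.


(** One step of the zigzag: Y times the differential is a Koszul cycle, hence the Koszul boundary of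
    some Z in F_p, to which the case p applies; Y minus the Koszul boundary of the resulting U is
    killed by the differential. *)
Lemma tor_vanishesS i j p : (p < i)%N ->
  tor_vanishes i j p -> tor_vanishes i j p.+1.
Proof.
move=> pi IH Y Yhom cyc.
pose Y1 S := Y S *m diff E p.
have Y1supp S b g : g \in msupp (Y1 S 0 b) -> exists a g1 g2,
    [/\ g1 \in msupp (Y S 0 a), g2 \in msupp (diff E p a b) & g = (g1 + g2)%MM].
  rewrite /Y1 mxE => /msupp_sum_le/flattenP[s /mapP[a _ ->]].
  by move=> /msuppM_le/allpairsP[[g1 g2] /= [h1 h2 ->]]; exists a, g1, g2.
(* In Koszul degree 0 exactness needs entries without constant term; the condition on g records that
   minimality provides this. *)
have [|||Z [Zhom ZE]] := @krow_exact n F _ setT (i - p.+1)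
    (fun b g => hom_degree j (p := p) b g /\ ((i - p.+1)%N = 0%N -> g != 0%MM)) Y1.
- move=> b g [_ g0] i0.
  case: (pickP (fun v => (0 < g v)%N)) => [v vg|gz].
    by exists v; rewrite !inE.
  move/eqP: (g0 i0) => []; apply/mnmP => v; rewrite mnm0E.
  by have := gz v; case: (g v).
- move=> S b g _ Si gS; have [a [g1 [g2 [h1 h2 gE]]]] := Y1supp _ _ _ gS; split.
    have := Yhom S a g1 _ h1; rewrite /hom_degree gE !mdegD => h.
    have := Egr h2; have := h ltac:(lia); lia.
  move=> i0; rewrite mnmD_eq0 gE mnmD_eq0 !negb_and; apply/orP; left; apply/orP; right.
  apply/eqP => g20; move: h2; rewrite g20 mcoeff_msupp Emin eqxx //.
- move=> S _ Si; have [|V hV] := cyc S; first by lia.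
  by rewrite -krowM hV diffK.
have [||U [W UW]] := IH Z.
- by move=> S a g _ /Zhom[].
- move=> S Si; exists (Y S); rewrite -ZE ?subsetT //; lia.
have hU' (S : {set 'I_n}) : exists w : row p.+2, (#|S| + p.+1)%N = i ->
    Y S - krow setT U S = w *m diff E p.+1.
  case: (eqVneq (#|S| + p.+1)%N i) => [Si|Si]; last by exists 0 => /eqP; rewrite (negPf Si).
  have [w hw] : exists w : row p.+2, Y S - krow setT U S = w *m diff E p.+1.
    apply/(Eex.2 p); rewrite mulmxBl -/(Y1 S) ZE ?subsetT //; last lia.
    rewrite krowM (krow_ext (Y := Z) (Z := fun V => U V *m diff E p + krow setT W V)).
      by rewrite krowD krow_krow addr0 subrr.
    move=> v _ vS; apply: UW; rewrite cardsU1 vS; lia.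
  by exists w.
have [U' U'P] := fin_all_exists hU'.
by exists U', U => S /U'P <-; rewrite subrK.
Qed.

(** At p = i only S = set0 matters and the cycle condition is empty. The basis vector at a would be
    an element of the image of F_(i+1) plus multiples of variables, all without constant term,
    against its entry 1. *)
Lemma twist_coloop_free i (a : 'I_(size (twists E i))) :
  exists T : {set 'I_n}, [/\ coloop_free nu T, nu T = i & #|T|%:Z = tw i a].
Proof.
have [//|hno] := classic (exists T : {set 'I_n},
  [/\ coloop_free nu T, nu T = i & #|T|%:Z = tw i a]).
have tv p : (p <= i)%N -> tor_vanishes i (tw i a) p.
  elim: p => [_|p IH pi]; first exact: tor_vanishes0.
  by apply: tor_vanishesS => //; apply: IH; exact: ltnW.
have [||U [W UW]] := tv i (leqnn i) (fun S => if S == set0 then delta_mx 0 a else 0).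
- move=> S b g Si; have /eqP -> : S == set0 by rewrite -cards_eq0; apply/eqP; lia.
  rewrite eqxx mxE eqxx /=; case: eqP => [->|_]; last by rewrite msupp0.
  by rewrite mnm_set0 addm0 msupp1 inE => /eqP ->; rewrite /hom_degree mdeg0 add0r.
- by move=> S Si; exfalso; lia.
have := UW set0; rewrite eqxx cards0 => /(_ erefl).
move/(congr1 (fun Y : row i => (Y 0 a)@_0)).
rewrite !mxE !eqxx mcoeff1 eqxx mcoeffD [X in _ = X + _]raddf_sum big1 /=; last first.
  by move=> b _; rewrite rmorphM /= Emin mulr0.
rewrite summxE raddf_sum big1 /=; last first.
  move=> v _; rewrite mxE !rmorphM /= mcoeffX mnm1_eq0.
  by rewrite mulr0 mul0r.
by rewrite addr0 => /eqP; rewrite oner_eq0.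
Qed.


(* The same zigzag in the opposite direction, with the Koszul complex on the
   variables in J only and without degrees. *)
Definition lifts_cycles (J : {set 'I_n}) (k p : nat) : Prop :=
  forall Y : {set 'I_n} -> row p,
  (forall S : {set 'I_n}, S \subset J -> (#|S|.+1 + p)%N = k ->
     exists V : row p.+1, krow J Y S = V *m diff E p) ->
  exists (U : {set 'I_n} -> row p.+1) (W : {set 'I_n} -> row p),
    forall S : {set 'I_n}, S \subset J -> (#|S| + p)%N = k ->
      Y S = U S *m diff E p + krow J W S.

(** The Koszul boundary of Y lifts through the differential to V, which the case p + 1 corrects by
    the Koszul boundary of W; Y minus the image of W is then a Koszul cycle in positive degree k -
    p, hence a boundary. *)
Lemma lifts_cycles_pred J k p : (p < k)%N ->
  lifts_cycles J k p.+1 -> lifts_cycles J k p.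
Proof.
move=> pk IH Y cyc.
have hV (S : {set 'I_n}) : exists V : row p.+1,
    S \subset J -> (#|S|.+1 + p)%N = k -> krow J Y S = V *m diff E p.
  case: (boolP (S \subset J)) => [sJ|_]; last by exists 0.
  case: (eqVneq (#|S|.+1 + p)%N k) => [Sk|Sk].
    by have [V h] := cyc S sJ Sk; exists V.
  by exists 0 => _ /eqP; rewrite (negPf Sk).
have [V VP] := fin_all_exists hV.
have [|U [W UW]] := IH V.
  move=> S sJ Sk; apply/(Eex.2 p); rewrite krowM (krow_ext (Z := krow J Y)) ?krow_krow //.
  move=> v vJ vS; rewrite -VP ?subUset ?sub1set ?vJ //.
  by rewrite cardsU1 vS; lia.
have [|||Z [_ ZP]] := @krow_exact n F _ J (k - p)%N (fun _ _ => True)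
    (fun S => Y S - W S *m diff E p).
- by move=> j g _ kp; exfalso; lia.
- by [].
- move=> S sJ Sk; rewrite krowB -krowM VP //; last lia.
  rewrite UW //; last lia.
  by rewrite mulmxDl diffK add0r subrr.
by exists W, Z => S sJ Sk; rewrite -ZP ?subrKC //; lia.
Qed.

(* With B a basis and J its complement, x_B e_J is a Koszul cycle modulo the ideal
   of top degree #|J|, and not a boundary since x_B is not in the ideal; a
   shorter resolution would make it one. *)
Lemma twists_nonempty i : (i <= nu setT)%N -> twists E i <> [::].
Proof.
move=> ik Ei; have [B [_ B0 Bc]] := nullity_basis nuP setT.
pose J := ~: B; pose k := #|J|.
have kE : k = nu setT.
  have := cardsC B; rewrite -/J -/k => h; move: Bc; rewrite cardsT; move: h.
  by rewrite card_ord; lia.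
have lc : lifts_cycles J k 0.
  (* As F_i = 0 there is nothing to lift at p = i; the property then descends to p = 0. *)
  have : lifts_cycles J k i.
    move=> Y _; exists (fun _ => 0), (fun _ => 0) => S _ _.
    by apply/rowP => -[j hj]; exfalso; move: hj; rewrite Ei.
  elim: i ik {Ei} => // p IH pk h; apply: IH; first exact: ltnW.
  by apply: lifts_cycles_pred => //; rewrite kE.
pose Y S : row 0 := if S == J then ('X_[mnm_set B])%:M else 0.
have [|U [W UW]] := lc Y.
  move=> S sJ; rewrite addn0 => Sk.
  have : in_sr nu (krow J Y S 0 0).
    have [v vJ vS] : exists2 v, v \in J & v \notin S.
      by apply/subsetPn; apply/negP => /subset_leq_card; rewrite -/k; lia.
    have JE : v |: S = J.
      by apply/eqP; rewrite eqEcard subUset sub1set vJ sJ cardsU1 vS -[#|J|]/k -Sk add1n leqnn.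
    rewrite summxE => g /msupp_sum_le/flattenP[s /mapP[u]].
    rewrite mem_filter in_setD => /andP[/andP[uS uJ] _] ->.
    have uB : u \notin B by move: uJ; rewrite inE.
    rewrite mxE /Y; case: eqP => [_|_]; last by rewrite mxE mulr0 msupp0.
    rewrite mxE eqxx mulr1n -mulrA -mpolyXD.
    move=> /msuppM_le/allpairsP[[g1 g2] /= [_ + ->]]; rewrite msuppX inE => /eqP ->.
    apply: (@leq_trans (nu (u |: B))); last first.
      apply: nullity_mono => //; rewrite !mnm_suppD mnm_supp_set; apply/subsetP => w.
      rewrite !inE mnm1E => /orP[/eqP->|->]; rewrite ?eqxx ?orbT //.
    rewrite lt0n; apply/negP => /eqP h.
    have := nullity_indep_card nuP (subsetT _) h; rewrite cardsU1 uB; lia.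
  move/in_sr_im => [w hw]; exists w; rewrite -hw.
  by apply/rowP => j; rewrite ord1 mxE eqxx mulr1n.
have := UW J (subxx _); rewrite addn0 => /(_ erefl).
rewrite {1}/Y eqxx /krow setDv big_set0 addr0 => h.
have /in_sr_im /(_ (mnm_set B)) : exists w : row 1, ('X_[mnm_set B])%:M = w *m diff E 0.
  by exists (U J).
by rewrite msuppX mem_head mnm_supp_set B0 => /(_ isT).
Qed.

End StanleyReisner.

(** * Construction of a minimal resolution *)

Section GreedyStep.
Variables (n : nat) (F : fieldType).
Implicit Types (S T : {set 'I_n}).

Definition masked b (lab : 'I_b -> {set 'I_n}) T (w : 'rV[F]_b) : Prop :=
  forall a, w 0 a != 0 -> lab a \subset T.

(** The rows of A, placed in the multidegrees [lab], generate the module whose strand at T is the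
    row space of [Z T]: a generator contributes to the strands at the sets containing its label. *)
Definition covers b (Z : {set 'I_n} -> 'M[F]_b) c (lab : 'I_c -> {set 'I_n})
    (A : 'M[F]_(c, b)) : Prop :=
  (forall a, (row a A <= Z (lab a))%MS) /\
  (forall T (v : 'rV_b), (v <= Z T)%MS -> exists2 w, masked lab T w & v = w *m A).

Lemma covers_full b (Z : {set 'I_n} -> 'M[F]_b) :
  exists c (lab : 'I_c -> {set 'I_n}) (A : 'M[F]_(c, b)), covers Z lab A.
Proof.
pose I := ({set 'I_n} * 'I_b)%type.
pose A : 'M[F]_(#|{: I}|, b) := \matrix_(a, j) Z (enum_val a).1 (enum_val a).2 j.
exists #|{: I}|, (fun a => (enum_val a).1), A; split.
  move=> a; have -> : row a A = row (enum_val a).2 (Z (enum_val a).1).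
    by apply/rowP => j; rewrite !mxE.
  exact: row_sub.
move=> T v /submxP[D vE].
exists (\row_a if (enum_val a).1 == T then D 0 (enum_val a).2 else 0).
  by move=> a; rewrite mxE; case: (eqVneq (enum_val a).1 T) => [->|]; rewrite ?eqxx.
apply/rowP => j; rewrite vE !mxE.
under [RHS]eq_bigr do rewrite !mxE.
rewrite -(big_enum_val (A := {: I}) (fun p : I =>
  (if p.1 == T then D 0 p.2 else 0) * Z p.1 p.2 j)) /=.
rewrite -(pair_bigA _ (fun p q => (if p == T then D 0 q else 0) * Z p q j)) /=.
rewrite (bigD1 T) //= eqxx [X in _ + X]big1 ?addr0 // => U /negPf ->.
by apply: big1 => q _; rewrite mul0r.
Qed.

Lemma covers_relabel b (Z : {set 'I_n} -> 'M[F]_b) c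
    (lab : 'I_c -> {set 'I_n}) (A : 'M[F]_(c, b)) a0 T0 :
  covers Z lab A -> T0 \subset lab a0 -> (row a0 A <= Z T0)%MS ->
  covers Z (fun a => if a == a0 then T0 else lab a) A.
Proof.
move=> [h1 h2] sT hT; split; first by move=> a; case: eqP => [->|].
move=> T v /h2[w wT vE]; exists w => // a /wT; case: eqP => // ->.
exact: subset_trans.
Qed.

(** The relation w expresses the row a0 through rows whose labels lie inside its own, so this row
    can be eliminated from every combination without leaving the multidegree. *)
Lemma covers_drop b (Z : {set 'I_n} -> 'M[F]_b) c
    (lab : 'I_c.+1 -> {set 'I_n}) (A : 'M[F]_(c.+1, b)) a0 w :
  covers Z lab A -> w *m A = 0 -> masked lab (lab a0) w -> w 0 a0 != 0 ->
  covers Z (fun a : 'I_c => lab (lift a0 a)) (row' a0 A).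
Proof.
move=> [h1 h2] wA wm w0; split.
  by move=> a; have -> : row a (row' a0 A) = row (lift a0 a) A by apply/rowP => j; rewrite !mxE.
move=> T v /h2[u uT vE]; pose u' := u - (u 0 a0 / w 0 a0) *: w.
have u'0 : u' 0 a0 = 0 by rewrite !mxE divfK // subrr.
have u'T : masked lab T u'.
  move=> a; rewrite !mxE; case: (eqVneq (u 0 a) 0) => [->|/uT//].
  case: (eqVneq (u 0 a0) 0) => [->|/uT sT].
    by rewrite mul0r mul0r subrr eqxx.
  case: (eqVneq (w 0 a) 0) => [->|/wm sa _]; first by rewrite mulr0 subrr eqxx.
  exact: subset_trans sT.
exists (\row_a u' 0 (lift a0 a)); first by move=> a; rewrite mxE => /u'T.
have -> : v = u' *m A by rewrite mulmxBl -scalemxAl wA scaler0 subr0.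
apply/rowP => j; rewrite !mxE (bigD1_ord a0) //= u'0 mul0r add0r.
by apply: eq_bigr => a _; rewrite !mxE.
Qed.

(* Among all covers take one minimizing the sum of #|lab a|.+1: otherwise a row
   could be dropped, or relabelled by a smaller set. *)
Lemma minimal_cover b (Z : {set 'I_n} -> 'M[F]_b) :
  exists c (lab : 'I_c -> {set 'I_n}) (A : 'M[F]_(c, b)),
  [/\ covers Z lab A,
      forall w a, w *m A = 0 -> masked lab (lab a) w -> w 0 a = 0
    & forall a T, T \proper lab a -> ~ (row a A <= Z T)%MS].
Proof.
pose wt c (lab : 'I_c -> {set 'I_n}) := (\sum_a #|lab a|.+1)%N.
have main m : forall c (lab : 'I_c -> {set 'I_n}) (A : 'M[F]_(c, b)),
    covers Z lab A -> (wt c lab <= m)%N ->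
    exists c (lab : 'I_c -> {set 'I_n}) (A : 'M[F]_(c, b)),
    [/\ covers Z lab A,
        forall w a, w *m A = 0 -> masked lab (lab a) w -> w 0 a = 0
      & forall a T, T \proper lab a -> ~ (row a A <= Z T)%MS].
  elim: m => [|m IH] c lab A hA hm.
    case: c lab A hA hm => [|c] lab A hA hm.
      by exists 0%N, lab, A; split=> // [w []|[]].
    by move: hm; rewrite /wt (bigD1 ord0).
  case: (classic (exists w a, [/\ w *m A = 0, masked lab (lab a) w & w 0 a != 0])).
    move=> [w [a [wA wm wa]]]; case: c lab A hA hm w a wA wm wa => [|c] lab A hA hm w a wA wm wa.
      by case: a {wm wa}.
    apply: (IH _ _ _ (covers_drop hA wA wm wa)).
    move: hm; rewrite /wt (bigD1_ord a) //= addSn ltnS; apply: leq_trans; exact: leq_addl.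
  move=> no1; case: (classic (exists a T, T \proper lab a /\ (row a A <= Z T)%MS)).
    move=> [a [T [sT hT]]].
    apply: (IH _ _ _ (covers_relabel hA (proper_sub sT) hT)).
    have := proper_card sT; move: hm; rewrite /wt (bigD1 a) //= [X in (X <= m)%N](bigD1 a) //= eqxx.
    rewrite [X in (_ + X <= m)%N](eq_bigr (fun i => #|lab i|.+1)); last by move=> i /negPf ->.
    by move=> h1 h2; rewrite -ltnS (leq_trans _ h1) // ltn_add2r ltnS.
  move=> no2; exists c, lab, A; split => //.
    move=> w a wA wm; apply/eqP/negPn/negP => wa; apply: no1; by exists w, a.
  by move=> a T sT hT; apply: no2; exists a, T.
have [c [lab [A hA]]] := covers_full Z.
exact: main hA (leqnn _).
Qed.

End GreedyStep.

Section MinimalResolution.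
Variables (n : nat) (F : fieldType) (nu : {set 'I_n} -> nat).
Hypothesis nuP : nullity nu.
Implicit Types (S T : {set 'I_n}).

(* [cyc s T] spans the cycles of the strand of the resolution in squarefree
   multidegree T; [lab s] lists the multidegrees of the free module. *)
Record state := State {
  rk : nat;
  lab : 'I_rk -> {set 'I_n};
  cyc : {set 'I_n} -> 'M[F]_rk }.

Record step (s : state) := Step {
  step_rk : nat;
  step_lab : 'I_step_rk -> {set 'I_n};
  step_mx : 'M[F]_(step_rk, rk s);
  step_cov : covers (cyc s) step_lab step_mx;
  step_ker : forall w a, w *m step_mx = 0 -> masked step_lab (step_lab a) w -> w 0 a = 0;
  step_low : forall a T, T \proper step_lab a -> ~ (row a step_mx <= cyc s T)%MS }.

Lemma step_ex (s : state) : inhabited (step s).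
Proof.
have [c [l [A [h1 h2 h3]]]] := minimal_cover (cyc s).
by constructor; exists c l A.
Qed.

Definition next_step s : step s := epsilon (step_ex s) (fun _ => True).

(** It turns [masked l T w] into the linear condition that w times this matrix is 0, so that the
    cycles of a strand are again a kernel. *)
Definition mask b (l : 'I_b -> {set 'I_n}) T : 'M[F]_b :=
  diag_mx (\row_a (~~ (l a \subset T))%:R).

Definition next s : state := let t := next_step s in
  State (@step_lab s t) (fun T => kermx (row_mx (step_mx t) (mask (@step_lab s t) T))).

Lemma cyc_next s T (w : 'rV[F]_(rk (next s))) :
  (w <= cyc (next s) T)%MS <->
  w *m step_mx (next_step s) = 0 /\ masked (lab (s := next s)) T w.
Proof.
rewrite /= (sameP sub_kermxP eqP) mul_mx_row -row_mx0.
split.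
  move=> /eqP/eq_row_mx[-> /rowP h]; split=> // a wa.
  have := h a; rewrite /mask mul_mx_diag !mxE => /eqP.
  by rewrite mulf_eq0 (negPf wa) /=; case: (_ \subset _) => //; rewrite oner_eq0.
move=> [-> h]; apply/eqP; congr row_mx; apply/rowP => a.
rewrite /mask mul_mx_diag !mxE; case: (eqVneq (w 0 a) 0) => [->|/h ->].
  by rewrite mul0r.
by rewrite mulr0.
Qed.

(** One generator, with label [set0], whose cycles are the ideal: x_T belongs to it exactly if T is
    dependent. *)
Definition state0 : state :=
  State (fun _ : 'I_1 => set0) (fun T => if (0 < nu T)%N then 1%:M else 0).

(** [inv_low] makes the nullity of the next labels exceed i, which bounds the length; [inv_coloop]
    makes these labels coloop-free; [inv_top] and [inv_masked] make labels grow strictly along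
    nonzero entries, which is minimality. *)
Record invariant (i : nat) (s : state) : Prop := Invariant {
  inv_low : forall T v, (nu T <= i)%N -> (v <= cyc s T)%MS -> v = 0 :> 'rV_(rk s);
  inv_coloop : forall T e (v : 'rV_(rk s)), e \in T -> nu (T :\ e) = nu T ->
    (v <= cyc s T)%MS -> (v <= cyc s (T :\ e))%MS;
  inv_mono : forall S T (v : 'rV_(rk s)), S \subset T -> (v <= cyc s S)%MS -> (v <= cyc s T)%MS;
  inv_masked : forall T (v : 'rV_(rk s)), (v <= cyc s T)%MS -> masked (lab (s := s)) T v;
  inv_top : forall a (v : 'rV_(rk s)), (v <= cyc s (lab a))%MS -> v 0 a = 0 }.

Lemma invariant0 : invariant 0 state0.
Proof.
split=> /=.
- by move=> T v; rewrite leqn0 => /eqP ->; rewrite submx0 => /eqP.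
- by move=> T e v eT ->.
- move=> S T v sST; have := nullity_mono nuP sST; case: (nu S) => [|k].
    by rewrite submx0 => _ /eqP ->; rewrite sub0mx.
  by case: (nu T) => // l _ _; rewrite submx1.
- by move=> T v _ a _; rewrite sub0set.
- by move=> a v; rewrite (nullity_set0 nuP) submx0 => /eqP ->; rewrite mxE.
Qed.

Section Next.
Variables (i : nat) (s : state).
Hypothesis inv : invariant i s.
Let t := next_step s.

(** A coloop could be removed from the label, against [step_low]. *)
Lemma next_coloop_free a : coloop_free nu (lab (s := next s) a).
Proof.
move=> e ea; rewrite ltn_neqAle nullity_mono ?subsetDl // andbT.
apply/negP => /eqP he; apply: (step_low (s := s) (a := a) (T := lab a :\ e)).
  by rewrite properD1.
apply: (inv_coloop inv) => //; exact: (step_cov t).1.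
Qed.

Lemma next_gt a : (i < nu (lab (s := next s) a))%N.
Proof.
rewrite ltnNge; apply/negP => h.
have r0 := inv_low inv h ((step_cov t).1 a).
have := @step_ker s t (delta_mx 0 a) a; rewrite -rowE r0 !mxE !eqxx.
have hm : masked (lab (s := next s)) (lab a) (delta_mx 0 a : 'rV[F]__).
  by move=> c; rewrite mxE eqxx /=; case: (eqVneq c a) => [->|]; rewrite ?eqxx.
by move=> /(_ erefl hm) /eqP; rewrite oner_eq0.
Qed.

Lemma next_proper a c : step_mx t a c != 0 -> lab c \proper lab (s := next s) a.
Proof.
have h := (step_cov t).1 a => ac.
have ac' : row a (step_mx t) 0 c != 0 by rewrite mxE.
rewrite properEneq (inv_masked inv h ac') andbT.
apply: contraNneq ac' => E; apply/eqP; apply: (inv_top inv); rewrite E; exact: h.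
Qed.

Lemma invariant_next : invariant i.+1 (next s).
Proof.
split.
- (* T has only one coloop-free subset of full nullity, so all the labels occurring
     in v are equal. *)
  move=> T v hT /cyc_next[vA vm]; apply/rowP => a; rewrite [RHS]mxE.
  apply/eqP/negPn/negP => va; have laT := vm _ va.
  have nuE c : lab (s := next s) c \subset T -> nu (lab (s := next s) c) = nu T.
    by move=> /(nullity_mono nuP) h; have := next_gt c; lia.
  move/eqP: va; apply; apply: step_ker => // c vc; have lcT := vm _ vc.
  suff E : lab (s := next s) c = lab (s := next s) a.
    by move: (subxx (lab (s := next s) a)); rewrite -{1}E.
  apply: (coloop_free_core_uniq nuP lcT laT); rewrite ?nuE //; exact: next_coloop_free.
- move=> T e v eT he /cyc_next[vA vm]; apply/cyc_next; split=> // a va.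
  apply/subsetD1P; split; first exact: vm.
  apply/negP => ea; have := next_coloop_free ea.
  by rewrite -(coloop_sub nuP (vm _ va) eT he) (setUidPr _) ?sub1set // ltnn.
- move=> S T v sST /cyc_next[vA vm]; apply/cyc_next; split=> // a /vm.
  by move=> h; apply: subset_trans sST.
- by move=> T v /cyc_next[].
- by move=> a v /cyc_next[vA vm]; apply: step_ker.
Qed.

End Next.

Fixpoint states (i : nat) : state :=
  if i is j.+1 then next (states j) else state0.

Lemma states_inv i : invariant i (states i).
Proof. by elim: i => [|i IH]; [exact: invariant0 | exact: invariant_next]. Qed.

Definition res_mx i : 'M[F]_(rk (states i.+1), rk (states i)) :=
  step_mx (next_step (states i)).

End MinimalResolution.

(** * Multigraded components of free modules *)

Section Strands.
Variables (n : nat) (F : fieldType).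
Implicit Types (S T : {set 'I_n}) (g : 'X_{1..n}).
Local Notation R := {mpoly F[n]}.

Definition strand b (l : 'I_b -> {set 'I_n}) g (v : 'rV[R]_b) : 'rV[F]_b :=
  \row_a if l a \subset mnm_supp g then (v 0 a)@_(g - mnm_set (l a)) else 0.

Definition strand_mx b c (l : 'I_b -> {set 'I_n}) (l' : 'I_c -> {set 'I_n})
    (A : 'M[F]_(b, c)) : 'M[R]_(b, c) :=
  \matrix_(i, j) (A i j *: 'X_[mnm_set (l i :\: l' j)]).

Lemma strand_masked b (l : 'I_b -> {set 'I_n}) g v :
  masked l (mnm_supp g) (strand l g v).
Proof. by move=> a; rewrite mxE; case: ifP => //; rewrite eqxx. Qed.

Lemma strand_inj b (l : 'I_b -> {set 'I_n}) v w :
  (forall g, strand l g v = strand l g w) -> v = w.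
Proof.
move=> h; apply/rowP => a; apply/mpolyP => k.
have /rowP/(_ a) := h (k + mnm_set (l a))%MM.
by rewrite !mxE addmK mnm_suppD mnm_supp_set subsetUr.
Qed.

Lemma strand0 b (l : 'I_b -> {set 'I_n}) g : strand l g 0 = 0.
Proof. by apply/rowP => a; rewrite !mxE mcoeff0 if_same. Qed.

Lemma strandM b c (l : 'I_b -> {set 'I_n}) (l' : 'I_c -> {set 'I_n})
    (A : 'M[F]_(b, c)) g v :
  (forall i j, A i j != 0 -> l' j \subset l i) ->
  strand l' g (v *m strand_mx l l' A) = strand l g v *m A.
Proof.
move=> hA; apply/rowP => j; rewrite !mxE; case: ifP => sj.
  rewrite raddf_sum; apply: eq_bigr => i _ /=; rewrite !mxE.
  rewrite -scalerAr mcoeffZ mulrC; case: (eqVneq (A i j) 0) => [->|/hA sji].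
    by rewrite !mulr0.
  congr (_ * _); rewrite mulrC mcoeff_setXM //; last first.
    by rewrite -setI_eq0 setIDAC setDIl setDv setI0.
  have -> : l i :\: l' j :|: l' j = l i.
    by rewrite setUC setDE setUIr setUCr setIT; apply/setUidPr.
  congr (if _ then _ else _); rewrite -{2}(setID (l i) (l' j)) subUset (setIidPr sji) sj.
  by [].
rewrite big1 // => i _; rewrite mxE.
case: (eqVneq (A i j) 0) => [->|/hA sji]; first by rewrite mulr0.
by case: ifP => [si|_]; [rewrite (subset_trans sji si) in sj | rewrite mul0r].
Qed.

Lemma strand_lift b (l : 'I_b -> {set 'I_n}) (W : 'X_{1..n} -> 'rV[F]_b)
    (G : seq 'X_{1..n}) :
  uniq G -> (forall g, masked l (mnm_supp g) (W g)) ->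
  exists u, forall g, strand l g u = if g \in G then W g else 0.
Proof.
move=> uG hW.
exists (\row_a \sum_(k <- G) (if l a \subset mnm_supp k then W k 0 a else 0)
   *: 'X_[k - mnm_set (l a)]) => g.
apply/rowP => a; rewrite !mxE; case: ifP => sa.
  by rewrite (mcoeff_assemble (fun k => W k 0 a)) //; case: ifP => // _; rewrite mxE.
case: ifP => _; last by rewrite mxE.
by case: (eqVneq (W g 0 a) 0) => [->//|/hW]; rewrite sa.
Qed.

Lemma strand_finite b (l : 'I_b -> {set 'I_n}) v :
  exists2 G : seq 'X_{1..n}, uniq G & forall g, g \notin G -> strand l g v = 0.
Proof.
pose G := undup (flatten [seq [seq (g + mnm_set (l a))%MM | g <- msupp (v 0 a)]
   | a <- enum 'I_b]).
exists G; first exact: undup_uniq.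
move=> g gG; apply/rowP => a; rewrite !mxE; case: ifP => // sa.
apply/eqP; rewrite mcoeff_eq0; apply: contra gG => ga; rewrite mem_undup.
apply/flattenP; exists [seq (g + mnm_set (l a))%MM | g <- msupp (v 0 a)].
  by apply: map_f; rewrite mem_enum.
by apply/mapP; exists (g - mnm_set (l a))%MM => //; rewrite mnm_setK.
Qed.

End Strands.

(** * The resolution assembled from its strands *)

Section Resolution.
Variables (n : nat) (F : fieldType) (nu : {set 'I_n} -> nat).
Hypothesis nuP : nullity nu.
Implicit Types (S T : {set 'I_n}) (g : 'X_{1..n}).
Local Notation R := {mpoly F[n]}.
Local Notation st := (states F nu).
Local Notation lb i := (@lab n F (st i)).

Definition res_diff i : 'M[R]_(rk (st i.+1), rk (st i)) :=
  strand_mx (lb i.+1) (lb i) (res_mx F nu i).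

Let inv i : invariant nu i (st i) := states_inv F nuP i.

Lemma res_mx_proper i a c : res_mx F nu i a c != 0 -> lb i c \proper lb i.+1 a.
Proof. exact: (next_proper (inv i)). Qed.

Lemma strand_res_diff i g v :
  strand (lb i) g (v *m res_diff i) = strand (lb i.+1) g v *m res_mx F nu i.
Proof. by apply: strandM => a c /res_mx_proper/proper_sub. Qed.

(** In multidegree g only the support of g matters, as the labels are squarefree; the cover at this
    support lifts the component, and finitely many lifts make up polynomial entries. *)
Lemma res_im i (v : 'rV[R]_(rk (st i))) :
  (forall g, (strand (lb i) g v <= cyc (st i) (mnm_supp g))%MS) <->
  exists w, v = w *m res_diff i.
Proof.
split=> [h|[w ->] g]; last first.
  rewrite strand_res_diff mulmx_sum_row summx_sub // => a _.
  have [->|wa] := eqVneq (strand (lb i.+1) g w 0 a) 0; first by rewrite scale0r sub0mx.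
  apply: scalemx_sub; apply: (inv_mono (inv i)) (strand_masked wa) _.
  exact: (step_cov (next_step (st i))).1.
pose lifts g (w : 'rV[F]_(rk (st i.+1))) :=
  masked (lb i.+1) (mnm_supp g) w /\ strand (lb i) g v = w *m res_mx F nu i.
have [W WP] : exists W, forall g, True -> lifts g (W g).
  apply: (@choice_in _ _ (fun _ => True) lifts 0) => g _.
  have [w wm wE] := (step_cov (next_step (st i))).2 _ _ (h g).
  by exists w.
have [G uG GP] := strand_finite (lb i) v.
have [u uE] := strand_lift uG (fun g => (WP g I).1).
exists u; apply: (strand_inj (l := lb i)) => g; rewrite strand_res_diff uE.
by case: ifP => [_|/negbT/GP ->]; [exact: (WP g I).2 | rewrite mul0mx].
Qed.

Lemma res_exact i (v : 'rV[R]_(rk (st i.+1))) :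
  v *m res_diff i = 0 <-> exists w, v = w *m res_diff i.+1.
Proof.
rewrite -res_im; split=> [h g|h].
  apply/cyc_next; split; last exact: strand_masked.
  by rewrite -[X in _ *m X]/(res_mx F nu i) -strand_res_diff h strand0.
apply: (strand_inj (l := lb i)) => g; rewrite strand_res_diff strand0.
by have /cyc_next[] := h g.
Qed.

Lemma res_augment (f : R) :
  in_sr nu f <-> exists w, (f%:M : 'rV_(rk (st 0))) = w *m res_diff 0.
Proof.
rewrite -res_im.
have sE g : strand (lb 0) g (f%:M : 'rV_(rk (st 0))) = (f@_g)%:M.
  apply/rowP => a; rewrite !mxE /= sub0set mnm_set0 subm0 (ord1 a) eqxx.
  by rewrite !mulr1n.
split=> h g.
  rewrite sE /=; case: ifP => [_|/negP g0]; first exact: submx1.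
  rewrite (_ : f@_g = 0) ?raddf0 ?sub0mx //.
  by apply/eqP; rewrite mcoeff_eq0; apply/negP => /h.
move=> gf; have := h g; rewrite sE /=; case: ifP => // _.
rewrite submx0 => /eqP/matrixP/(_ 0 0); rewrite !mxE eqxx mulr1n => /eqP.
by rewrite mcoeff_eq0 gf.
Qed.

Lemma rk_eq0 i : (nu setT < i)%N -> rk (st i) = 0%N.
Proof.
case: i => // i hi; case E : (rk (st i.+1)) => [//|k].
have a : 'I_(rk (st i.+1)) by rewrite E; exact: ord0.
have := next_gt (inv i) a; have := nullity_mono nuP (subsetT (lb i.+1 a)).
by rewrite -[next _]/(st i.+1); lia.
Qed.

Definition res_syz i : seq int := [seq (#|lb i.+1 a|)%:Z | a : 'I_(rk (st i.+1))].

Lemma size_res_syz i : size (twists_of res_syz i) = rk (st i).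
Proof. by case: i => //= i; rewrite size_map size_enum_ord. Qed.

Lemma nth_res_syz i (a : 'I_(size (twists_of res_syz i))) :
  (twists_of res_syz i)`_a = (#|lb i (cast_ord (size_res_syz i) a)|)%:Z.
Proof.
case: i a => [|i] a /=; first by case: a => -[|[]] //= _; rewrite cards0.
have ha : (a < rk (st i.+1))%N by rewrite -(size_res_syz i.+1) ltn_ord.
rewrite (nth_map (Ordinal ha)) ?size_enum_ord //.
by congr (#|lb i.+1 _|)%:Z; apply: val_inj; rewrite /= nth_enum_ord.
Qed.

Definition resolution : free_seq F n :=
  @FreeSeq F n res_syz (fun i =>
    castmx (esym (size_res_syz i.+1), esym (size_res_syz i)) (res_diff i)).

Lemma mul_castmx (b b' c c' : nat) (eb : b' = b) (ec : c' = c)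
    (v : 'rV[R]_b') (D : 'M[R]_(b, c)) :
  v *m castmx (esym eb, esym ec) D =
  castmx (erefl, esym ec) (castmx (erefl, eb) v *m D).
Proof. by case: b / eb D => D; case: c / ec D => D; rewrite !castmx_id. Qed.

Lemma castrowK (b b' : nat) (e : b' = b) (v : 'rV[R]_b') :
  castmx (erefl, esym e) (castmx (erefl, e) v) = v.
Proof. by case: b / e; rewrite !castmx_id. Qed.

Lemma castrowKV (b b' : nat) (e : b' = b) (v : 'rV[R]_b) :
  castmx (erefl, e) (castmx (erefl, esym e) v) = v.
Proof. by case: b / e v => v; rewrite !castmx_id. Qed.

Lemma castrow0 (b b' : nat) (e : b' = b) : castmx (erefl, e) (0 : 'rV[R]_b') = 0.
Proof. by case: b / e; rewrite castmx_id. Qed.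

Lemma resolution_im i (v : 'rV[R]_(size (twists resolution i))) :
  (exists w, v = w *m diff resolution i) <->
  exists w, castmx (erefl, size_res_syz i) v = w *m res_diff i.
Proof.
split=> -[w h].
  exists (castmx (erefl, size_res_syz i.+1) w).
  by rewrite h /= mul_castmx castrowKV.
exists (castmx (erefl, esym (size_res_syz i.+1)) w).
by rewrite /= mul_castmx castrowKV -h castrowK.
Qed.

Lemma resolutionP (face : {set 'I_n} -> bool) :
  (forall S, face S = (nu S == 0%N)) ->
  minimal_graded_resolution (nu setT) (sr_ideal face) resolution.
Proof.
move=> faceE; split.
- move=> i a b m; rewrite castmxE !esymK => hm.
  rewrite (nth_res_syz (i := i.+1)) (nth_res_syz (i := i)).
  move: (cast_ord _ a) (cast_ord _ b) hm => {}a {}b.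
  rewrite mxE; have [->|/res_mx_proper/proper_sub sab] := eqVneq (res_mx F nu i a b) 0.
    by rewrite scale0r msupp0.
  move=> /msuppZ_le; rewrite msuppX inE => /eqP ->.
  rewrite mdeg_set cardsD (setIidPr sab) -subzn //; exact: subset_leq_card.
- split=> [f|i v].
    rewrite (sr_idealP (nu := nu)) // res_augment resolution_im.
    set e := size_res_syz 0; rewrite (_ : castmx _ _ = f%:M) //.
    by apply/rowP => j; rewrite castmxE !mxE !ord1.
  rewrite resolution_im -res_exact /= mul_castmx; split=> h.
    by rewrite -[LHS](castrowKV (size_res_syz i)) h castrow0.
  by rewrite h castrow0.
(* A nonzero entry is a scalar times x_V, where V is the nonempty difference of two labels. *)
- move=> i a b; rewrite castmxE mxE mcoeffZ mcoeffX.
  set x := res_mx _ _ _ _ _; have [->|/res_mx_proper/properP[_ [v va vb]]] := eqVneq x 0.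
    by rewrite mul0r.
  case: eqP => [/mnmP/(_ v)|]; last by rewrite mulr0.
  by rewrite mnm_setE in_setD va vb mnm0E.
- move=> i hi; apply: size0nil; rewrite [size _](size_res_syz i); exact: rk_eq0.
Qed.

End Resolution.

(** * The matroid of a linear code *)

Section CodeNullity.
Variables (n : nat) (F : fieldType) (C : {vspace 'rV[F]_n}).
Implicit Types (S T : {set 'I_n}) (c : 'rV[F]_n).

Definition subcode T : {vspace 'rV[F]_n} :=
  (C :&: lker (linfun (mulmxr (diag_mx (\row_j (j \notin T)%:R)))))%VS.

Definition code_nullity T : nat := \dim (subcode T).

Lemma subcodeP T c :
  reflect (c \in C /\ forall j, j \notin T -> c 0 j = 0) (c \in subcode T).
Proof.
rewrite memv_cap memv_ker lfunE /=; apply: (iffP andP) => -[cC h]; split=> //.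
  move=> j jT; move/eqP/rowP/(_ j): h; rewrite mul_mx_diag !mxE jT mulr1 //.
apply/eqP/rowP => j; rewrite mul_mx_diag !mxE; case: (boolP (j \in T)) => jT /=.
  by rewrite mulr0.
by rewrite h // mul0r.
Qed.

Lemma subcodeS S T : S \subset T -> (subcode S <= subcode T)%VS.
Proof.
move=> /subsetP sST; apply/subvP => c /subcodeP[cC h]; apply/subcodeP; split=> // j jT.
by apply: h; apply: contra jT; exact: sST.
Qed.

Lemma code_nullity_gain T e : e \notin T ->
  reflect (exists2 c, c \in subcode (e |: T) & c 0 e != 0)
    (code_nullity T < code_nullity (e |: T))%N.
Proof.
move=> eT; have sT := subcodeS (subsetUr [set e] T).
rewrite /code_nullity ltn_neqAle dimvS // andbT (dimv_leqif_sup sT).2.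
apply: (iffP idP) => [/subvPn[c cT h]|[c cT h]]; last apply/subvPn; exists c => //.
  apply: contra h => /eqP ce; have /subcodeP[cC h] := cT; apply/subcodeP; split=> // j jT.
  by case: (eqVneq j e) => [->//|je]; apply: h; rewrite !inE negb_or je.
by apply: contra h => /subcodeP[_ ->].
Qed.

(** Evaluation at e is a linear form, and a word supported in e |: T on which it vanishes is
    supported in T, so the dimension grows by at most one. A word supported in e |: S and nonzero at
    e serves for every larger T. *)
Lemma code_nullityP : nullity code_nullity.
Proof.
split.
- apply/eqP; rewrite dimv_eq0 -subv0; apply/subvP => c /subcodeP[_ h].
  by rewrite memv0; apply/eqP/rowP => j; rewrite h ?inE // mxE.
- move=> T e; rewrite dimvS ?subcodeS ?subsetUr //=.
  pose f : 'Hom('rV[F]_n, 'rV[F]_1) := linfun (mulmxr (delta_mx e 0)).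
  have := limg_ker_dim f (subcode (e |: T)).
  have : (\dim (f @: subcode (e |: T)) <= 1)%N.
    by apply: leq_trans (dimvS (subvf _)) _; rewrite dimvf /dim /= mul1n.
  suff : (\dim (subcode (e |: T) :&: lker f) <= code_nullity T)%N.
    by move=> h1 h2 h3; rewrite /code_nullity -h3 -[(\dim (subcode T)).+1]addn1 leq_add.
  apply/dimvS/subvP => c; rewrite memv_cap memv_ker lfunE /= => /andP[/subcodeP[cC h] ce].
  apply/subcodeP; split=> // j jT; case: (eqVneq j e) => [->|je].
    move/eqP/rowP/(_ 0): ce; rewrite !mxE (bigD1 e) //= !mxE !eqxx mulr1 big1 ?addr0 //.
    by move=> i ie; rewrite !mxE (negPf ie) mulr0.
  by apply: h; rewrite !inE negb_or je.
- move=> S T e sST eT; have eS : e \notin S by apply: contra eT; exact: (subsetP sST).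
  move=> /(code_nullity_gain eS)[c cS ce]; apply/(code_nullity_gain eT); exists c => //.
  by move: cS; apply/subvP/subcodeS; rewrite setUS.
Qed.

Lemma coloop_freeP T : coloop_free code_nullity T <->
  forall e, e \in T -> exists2 c, c \in subcode T & c 0 e != 0.
Proof.
have eN e : e \notin T :\ e by rewrite !inE eqxx.
split=> h e eT; have := h e eT.
  by rewrite -{2}(setD1K eT) => /(code_nullity_gain (eN e)); rewrite setD1K.
by move=> hc; rewrite -{2}(setD1K eT); apply/(code_nullity_gain (eN e)); rewrite setD1K.
Qed.

Lemma code_nullity_setT : code_nullity setT = \dim C.
Proof.
congr (\dim _); apply/vspaceP => c; apply/subcodeP/idP => [[]//|cC]; split=> // j.
by rewrite inE.
Qed.

Lemma code_nullity0P T :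
  reflect (forall c, c \in C -> (forall j, j \notin T -> c 0 j = 0) -> c = 0)
    (code_nullity T == 0%N).
Proof.
rewrite dimv_eq0 -subv0; apply: (iffP subvP) => h c.
  by move=> cC hc; apply/eqP; rewrite -memv0; apply: h; apply/subcodeP.
by move=> /subcodeP[cC hc]; rewrite memv0; apply/eqP/h.
Qed.

(** A linear relation between the columns indexed by T is a codeword supported in T; the work lies
    in passing between positions in [enum T] and elements of T. *)
Lemma code_faceE (H : 'M[F]_(n - \dim C, n)) : parity_check H ->
  forall T, code_face H T = (code_nullity T == 0%N).
Proof.
move=> [_ hH] T; rewrite /code_face.
pose X := [seq col i H | i <- enum T].
have sX : size X = #|T| by rewrite size_map -cardE.
have XE (i : 'I_(size X)) : X`_i = col (enum_val (cast_ord sX i)) H.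
  rewrite (nth_map (enum_val (cast_ord sX i))) -?cardE -?sX ?ltn_ord //.
  by rewrite [in RHS](enum_val_nth (enum_val (cast_ord sX i))).
have sumE c : (forall j, j \notin T -> c 0 j = 0) ->
    H *m c^T = \sum_(i < size X) c 0 (enum_val (cast_ord sX i)) *: X`_i.
  move=> hc; apply/colP => k; rewrite mxE summxE (bigID (mem T)) /=.
  rewrite [X in _ + X]big1 ?addr0; last by move=> j jT; rewrite mxE hc // mulr0.
  rewrite big_enum_val (reindex (cast_ord sX)) /=; last first.
    by exists (cast_ord (esym sX)) => i _; rewrite ?cast_ordK ?cast_ordKV.
  by apply: eq_bigr => i _; rewrite XE !mxE mulrC.
have fP := @freeP _ _ _ (in_tuple X).
apply/idP/idP => [/fP hf|/code_nullity0P h].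
  apply/code_nullity0P => c cC hc; apply/rowP => j; rewrite [RHS]mxE.
  case: (boolP (j \in T)) => [jT|]; last exact: hc.
  have /hf/(_ (cast_ord (esym sX) (enum_rank_in jT j))) :
    \sum_(i < size X) c 0 (enum_val (cast_ord sX i)) *: (in_tuple X)`_i = 0.
    by rewrite -sumE //; apply/hH.
  by rewrite cast_ordKV enum_rankK_in.
apply/fP => k hk i.
pose c : 'rV[F]_n := \row_j if j \in T =P true is ReflectT jT
  then k (cast_ord (esym sX) (enum_rank_in jT j)) else 0.
have ck i' : c 0 (enum_val (cast_ord sX i')) = k i'.
  rewrite mxE; case: eqP => [jT|]; last by rewrite enum_valP.
  by rewrite enum_valK_in cast_ordK.
have hc j : j \notin T -> c 0 j = 0.
  by move=> jN; rewrite mxE; case: eqP => // jT; rewrite jT in jN.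
have c0 : c = 0.
  apply: h => //; apply/hH; rewrite sumE // -[RHS]hk.
  by apply: eq_bigr => i' _; rewrite ck.
by rewrite -ck c0 mxE.
Qed.

End CodeNullity.

(** * Purity read off coloop-free sets and circuits *)

Section Purity.
Variables (n : nat) (F : fieldType) (C : {vspace 'rV[F]_n}).
Variable (H : 'M[F]_(n - \dim C, n)).
Hypothesis hH : parity_check H.
Implicit Types (S T : {set 'I_n}).

Let faceE := code_faceE hH.
Let nuP := code_nullityP C.

Lemma pure_of_equicardinal :
  (forall S T, coloop_free (code_nullity C) S -> coloop_free (code_nullity C) T ->
     code_nullity C S = code_nullity C T -> #|S| = #|T|) ->
  forall E : free_seq F n,
    minimal_graded_resolution (\dim C) (sr_ideal (code_face H)) E ->
    pure (\dim C) E.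
Proof.
move=> heq E [Egr Eex Emin Elen].
(* The default 0 is never reached, the list being nonempty for i up to [dim C]. *)
exists (fun i => head 0 (twists E i)) => i ik j.
have ne : twists E i <> [::].
  by apply: (twists_nonempty nuP faceE Eex); rewrite code_nullity_setT.
have twE (a b : 'I_(size (twists E i))) : (twists E i)`_a = (twists E i)`_b.
  have [S [cS nS <-]] := twist_coloop_free nuP faceE Egr Eex Emin a.
  have [T [cT nT <-]] := twist_coloop_free nuP faceE Egr Eex Emin b.
  by congr Posz; apply: heq; rewrite // nS nT.
have s0 : (0 < size (twists E i))%N by rewrite lt0n size_eq0; apply/eqP.
have hd : head 0 (twists E i) \in twists E i.
  by case: (twists E i) ne => // x s _; exact: mem_head.
split=> [/eqP|->]; last by apply/eqP; rewrite -lt0n -has_count has_pred1.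
rewrite -lt0n -has_count has_pred1 => jE.
have jl : (index j (twists E i) < size (twists E i))%N by rewrite index_mem.
have := twE (Ordinal jl) (Ordinal s0); rewrite /= nth_index // => ->.
Qed.

(** Some generator of the ideal has a monomial dividing x_T. Its support is dependent and contained
    in T, so the monomial is x_T and the generator has degree #|T|. *)
Lemma circuit_twist (E : free_seq F n) T :
  graded_maps E -> exact_over (sr_ideal (code_face H)) E ->
  ~~ code_face H T -> (forall e, e \in T -> code_face H (T :\ e)) ->
  #|T|%:Z \in twists E 1.
Proof.
move=> Egr Eex TN Tmin.
have [w wE] : exists w : 'rV_(size (twists E 1)),
    ('X_[mnm_set T])%:M = w *m diff E 0.
  apply/Eex.1/(sr_idealP nuP faceE) => g; rewrite msuppX inE => /eqP ->.
  by rewrite mnm_supp_set lt0n -faceE.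
have : mnm_set T \in msupp ((w *m diff E 0) 0 0).
  by rewrite -wE mxE eqxx mulr1n msuppX mem_head.
rewrite mxE => /msupp_sum_le/flattenP[s /mapP[a _ ->]].
move=> /msuppM_le/allpairsP[[g1 g2] /= [_ h2 gE]].
have g2T : mnm_supp g2 \subset T.
  by rewrite -[T]mnm_supp_set gE mnm_suppD subsetUr.
have g2N : (0 < code_nullity C (mnm_supp g2))%N.
  have : in_sr (code_nullity C) (diff E 0 a 0).
    apply/(sr_idealP nuP faceE)/Eex.1; exists (delta_mx 0 a).
    by rewrite -rowE; apply/rowP => j; rewrite !mxE ord1 eqxx.
  exact.
have g2E : mnm_supp g2 = T.
  apply/eqP; rewrite eqEsubset g2T; apply/subsetP => e eT; apply/negPn/negP => eg.
  move: (Tmin e eT); rewrite faceE => /eqP h; move: g2N; rewrite lt0n => /negP[].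
  by rewrite -leqn0 -h (nullity_mono nuP) //; apply/subsetD1P.
have g2d : g2 = mnm_set T.
  apply/mnmP => v; have /mnmP/(_ v) := gE; rewrite mnmDE mnm_setE.
  by move/setP/(_ v): g2E; rewrite inE; case: (v \in T); lia.
have := Egr _ _ _ _ h2; rewrite g2d mdeg_set /= subr0 => ->.
exact: mem_nth.
Qed.

(** The hypothesis is applied to the constructed resolution; position 1 is within its length since a
    circuit carries a nonzero word. *)
Lemma equal_circuits_of_pure S T :
  (forall E : free_seq F n,
    minimal_graded_resolution (\dim C) (sr_ideal (code_face H)) E ->
    pure (\dim C) E) ->
  ~~ code_face H S -> (forall e, e \in S -> code_face H (S :\ e)) ->
  ~~ code_face H T -> (forall e, e \in T -> code_face H (T :\ e)) ->
  #|S| = #|T|.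
Proof.
move=> hpure SN Smin TN Tmin.
have hE := resolutionP F nuP faceE; rewrite code_nullity_setT in hE.
have [d dP] := hpure _ hE; case: hE => Egr Eex _ _.
have k1 : (1 <= \dim C)%N.
  rewrite -code_nullity_setT; apply: leq_trans (nullity_mono nuP (subsetT S)).
  by rewrite lt0n -faceE.
have h (U : {set 'I_n}) : #|U|%:Z \in twists (resolution F (code_nullity C)) 1 -> #|U|%:Z = d 1%N.
  move=> hU; apply/(dP 1%N k1)/eqP; by rewrite -lt0n -has_count has_pred1.
have := h S (circuit_twist Egr Eex SN Smin); rewrite -(h T (circuit_twist Egr Eex TN Tmin)).
by case.
Qed.

End Purity.

(** * Polynomial functions over a finite field *)

Section PolynomialFunctions.
Variables (F : finFieldType) (m : nat).
Local Notation q := #|F|.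
Local Notation pt := 'rV[F]_m.
Implicit Types (x y u v p : pt) (g h : pt -> F).

(* Every polynomial function of degree at most d is also given by a polynomial
   of degree at most d with all exponents below q, so no such condition is
   imposed here. *)
Definition pfun (d : nat) g : Prop :=
  exists2 f : {mpoly F[m]}, (forall k, k \in msupp f -> (mdeg k <= d)%N)
    & forall x, g x = f.@[fun i => x 0 i].

Lemma eq_pfun d g h : g =1 h -> pfun d g -> pfun d h.
Proof. by move=> gh [f fd fg]; exists f => // x; rewrite -gh. Qed.

Lemma pfun_leq d e g : (d <= e)%N -> pfun d g -> pfun e g.
Proof. by move=> de [f fd fg]; exists f => // k /fd kd; apply: leq_trans de. Qed.

Lemma pfun_cst d (a : F) : pfun d (fun _ => a).
Proof.
exists a%:MP => [k|x]; last by rewrite mevalC.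
by rewrite msuppC; case: eqP => // _; rewrite inE => /eqP ->; rewrite mdeg0.
Qed.

Lemma pfun_coord i : pfun 1 (fun x => x 0 i).
Proof.
exists 'X_i => [k|x]; last by rewrite mevalXU.
by rewrite msuppX inE => /eqP ->; rewrite mdeg1.
Qed.

Lemma pfunD d g h : pfun d g -> pfun d h -> pfun d (fun x => g x + h x).
Proof.
move=> [f fd fg] [f' fd' fg']; exists (f + f') => [k|x]; last by rewrite mevalD -fg -fg'.
by move=> /msuppD_le; rewrite mem_cat => /orP[/fd|/fd'].
Qed.

Lemma pfunM d e g h : pfun d g -> pfun e h -> pfun (d + e) (fun x => g x * h x).
Proof.
move=> [f fd fg] [f' fd' fg']; exists (f * f') => [k|x]; last by rewrite mevalM -fg -fg'.
move=> /msuppM_le/allpairsP[[k1 k2] /= [h1 h2 ->]]; rewrite mdegD.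
by rewrite leq_add ?fd ?fd'.
Qed.

Lemma pfun_prod (I : Type) (s : seq I) (P : pred I) (d : I -> nat) (g : I -> pt -> F) :
  (forall i, P i -> pfun (d i) (g i)) ->
  pfun (\sum_(i <- s | P i) d i)%N (fun x => \prod_(i <- s | P i) g i x).
Proof.
move=> hg; elim: s => [|i s IH].
  by rewrite big_nil; apply: (eq_pfun _ (pfun_cst 0 1)) => x; rewrite big_nil.
rewrite big_cons; case: ifP => Pi.
  apply: (eq_pfun _ (pfunM (hg i Pi) IH)) => x; by rewrite big_cons Pi.
by apply: (eq_pfun _ IH) => x; rewrite big_cons Pi.
Qed.

Lemma pfun_lin i (a : F) : pfun 1 (fun x => x 0 i + a).
Proof. exact: pfunD (pfun_coord i) (pfun_cst 1 a). Qed.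

Lemma pfunZ d (a : F) g : pfun d g -> pfun d (fun x => a * g x).
Proof. exact: (pfunM (pfun_cst 0 a)). Qed.

Lemma big_row (R : Type) (idx : R) (op : Monoid.com_law idx) (G : pt -> R) :
  \big[op/idx]_x G x = \big[op/idx]_(h : {ffun 'I_m -> F}) G (\row_i h i).
Proof.
rewrite (reindex (fun h : {ffun 'I_m -> F} => \row_i h i)) //.
exists (fun x : pt => [ffun i => x 0 i]) => [h _|x _].
  by apply/ffunP => i; rewrite ffunE mxE.
by apply/rowP => i; rewrite mxE ffunE.
Qed.

Lemma card_gt1 : (1 < q)%N.
Proof.
rewrite (cardD1 0) inE /= (cardD1 1) !inE oner_neq0 /=; lia.
Qed.

(** For e = 0, shifting a by 1 in the sum of all a gives q = 0 in F. For e > 0 some b <> 0 has b^e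
    <> 1, because X^e - 1 has at most e < q - 1 roots, and substituting b a for a multiplies the sum
    by b^e. *)
Lemma power_sum0 e : (e < q.-1)%N -> \sum_(a : F) a ^+ e = 0.
Proof.
case: e => [_|e eq].
  have : \sum_(a : F) a = \sum_(a : F) (a + 1).
    by rewrite [LHS](reindex_inj (addIr (1 : F))).
  rewrite big_split /= -[X in X = _]addr0 => /addrI E; rewrite [RHS]E.
  by apply: eq_bigr => a _; rewrite expr0.
have [b b0 be] : exists2 b : F, b != 0 & b ^+ e.+1 != 1.
  case: (pickP (fun b : F => (b != 0) && (b ^+ e.+1 != 1))) => [b /andP[]|h].
    by exists b.
  have := @max_unity_roots F e.+1 (enum [set~ (0 : F)]) isT.
  move=> hu; have : ~~ all e.+1.-unity_root (enum [set~ (0 : F)]).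
    by apply/negP => /hu /(_ (enum_uniq _)); rewrite -cardE cardsC1 leqNgt eq.
  move=> /allPn[b]; rewrite mem_enum !inE => b0 /negP[].
  by apply/unity_rootP/eqP; have := h b; rewrite /= b0 => /negbFE.
have : \sum_(a : F) a ^+ e.+1 = b ^+ e.+1 * \sum_(a : F) a ^+ e.+1.
  rewrite [LHS](reindex_inj (mulfI b0)) mulr_sumr.
  by apply: eq_bigr => a _; rewrite exprMn.
move/eqP; rewrite -subr_eq0 -{1}[X in X - _]mul1r -mulrBl mulf_eq0 subr_eq0 eq_sym.
by rewrite (negPf be) /= => /eqP.
Qed.

(** A monomial of degree below m (q - 1) has an exponent below q - 1, and its sum over all points is
    a product of power sums. *)
Lemma sum_pfun0 d g : (d < m * q.-1)%N -> pfun d g -> \sum_x g x = 0.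
Proof.
move=> hd [f fd fg].
have E x : g x = \sum_(k <- msupp f) f@_k * \prod_i x 0 i ^+ k i by rewrite fg mevalE.
rewrite (eq_bigr _ (fun x _ => E x)) exchange_big /= big_seq big1 // => k /fd kd.
rewrite -mulr_sumr big_row.
have [i hi] : exists i, (k i < q.-1)%N.
  case: (pickP (fun i => (k i < q.-1)%N)) => [i hi|h]; first by exists i.
  have : (m * q.-1 <= mdeg k)%N.
    rewrite mdegE -{1}[m]card_ord -sum_nat_const; apply: leq_sum => i _.
    by rewrite leqNgt [X in ~~ X]h.
  lia.
under eq_bigr do under eq_bigr do rewrite mxE.
rewrite -(bigA_distr_bigA (fun i a => a ^+ k i)) (bigD1 i) //= power_sum0 //.
by rewrite mul0r mulr0.
Qed.

(* The sum of g * h over all points vanishes, for reasons of degree. *)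
Lemma pfun_point r d g h u :
  (r + d < m * q.-1)%N -> pfun r g -> pfun d h ->
  (forall x, x != u -> g x * h x = 0) -> h u != 0 -> g u = 0.
Proof.
move=> hrd gr hd gh hu; have := sum_pfun0 hrd (pfunM gr hd).
rewrite (bigD1 u) //= big1 ?addr0 //.
by move/eqP; rewrite mulf_eq0 (negPf hu) orbF => /eqP.
Qed.

(** The tool for the minimality of supports: a test function h that meets D at most in u and v
    transfers a zero of g from v to u. The circuits below are obtained by connecting the points of D
    through such pairs. *)
Lemma pfun_pair r d (D : {set pt}) g h u v :
  (r + d < m * q.-1)%N -> pfun r g -> pfun d h ->
  (forall x, x \notin D -> g x = 0) ->
  (forall x, x \in D -> h x != 0 -> x = u \/ x = v) ->
  h u != 0 -> g v = 0 -> g u = 0.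
Proof.
move=> hrd gr hd gD hD hu gv; apply: (pfun_point hrd gr hd) => // x xu.
case: (boolP (x \in D)) => xD; last by rewrite gD ?mul0r.
case: (eqVneq (h x) 0) => [->|/(hD x xD)[E|->]]; first by rewrite mulr0.
  by rewrite E eqxx in xu.
by rewrite gv mul0r.
Qed.

Lemma expr_reduce e : exists2 e', (e' < q)%N && (e' <= e)%N &
  forall a : F, a ^+ e = a ^+ e'.
Proof.
elim/ltn_ind: e => e IH; case: (ltnP e q) => he; first by exists e; rewrite ?he ?leqnn.
have q1 := card_gt1.
have [|e' /andP[h1 h2] h3] := IH (e - q).+1; first lia.
exists e'; first by rewrite h1 /=; lia.
by move=> a; rewrite -h3 exprSr -[X in _ * X](expf_card a) -exprD subnK.
Qed.

Lemma mem_reed_muller N (P : 'I_N -> pt) (C : {vspace 'rV[F]_N}) r g :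
  is_reed_muller r P C -> pfun r g -> \row_j g (P j) \in C.
Proof.
move=> hC [f fr fg].
have -> : \row_j g (P j) = \sum_(k <- msupp f) f@_k *: (\row_j \prod_i P j 0 i ^+ k i).
  apply/rowP => j; rewrite mxE fg mevalE summxE.
  by apply: eq_bigr => k _; rewrite !mxE.
rewrite big_seq; apply: rpred_sum => k /fr kr; apply: rpredZ.
have he i : exists e', ((e' < q)%N && (e' <= k i)%N) /\ (forall a : F, a ^+ k i = a ^+ e').
  by have [e' h1 h2] := expr_reduce (k i); exists e'.
have [e eP] := fin_all_exists he.
apply/hC; exists 'X_[[multinom e i | i < m]]; first split.
- rewrite msizeX ltnS; apply: leq_trans kr; rewrite !mdegE; apply: leq_sum => i _.
  by rewrite mnmE; have [/andP[]] := eP i.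
- by move=> k' i; rewrite msuppX inE => /eqP ->; rewrite mnmE; have [/andP[]] := eP i.
apply/rowP => j; rewrite !mxE mevalX; apply: eq_bigr => i _.
by rewrite mnmE (eP i).2.
Qed.

Lemma reed_muller_pfun N (P : 'I_N -> pt) (C : {vspace 'rV[F]_N}) r c :
  is_reed_muller r P C -> c \in C -> exists2 g, pfun r g & forall j, c 0 j = g (P j).
Proof.
move=> hC /hC[f [fr _] ->]; exists (fun x => f.@[fun i => x 0 i]).
  by exists f => // k /msize_mdeg_lt kf; rewrite -ltnS; apply: leq_trans fr.
by move=> j; rewrite mxE.
Qed.

Section Grids.
Variable A : 'I_m -> {set F}.

Definition grid : {set pt} := [set x : pt | [forall i, x 0 i \in A i]].
Definition grid_fun (B : 'I_m -> {set F}) x : F := \prod_i \prod_(a in B i) (x 0 i - a).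

Lemma grid_fun_neq0 (B : 'I_m -> {set F}) x : (grid_fun B x != 0) = [forall i, x 0 i \notin B i].
Proof.
rewrite /grid_fun; apply/prodf_neq0/forallP => h i.
  apply/negP => xB; have /prodf_neq0/(_ _ xB) := h i isT.
  by rewrite subrr eqxx.
move=> _; apply/prodf_neq0 => a aB; rewrite subr_eq0.
by apply: contraTneq aB => <-.
Qed.

Lemma pfun_grid (B : 'I_m -> {set F}) : pfun (\sum_i #|B i|)%N (grid_fun B).
Proof.
apply: pfun_prod => i _; rewrite -sum1_card.
by apply: pfun_prod => a _; apply: pfun_lin.
Qed.

Lemma card_grid : #|grid| = (\prod_i #|A i|)%N.
Proof.
rewrite -sum1_card big_mkcond big_row /=.
have E (h : {ffun 'I_m -> F}) : (if \row_i h i \in grid then 1 else 0)%N =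
    (\prod_i (h i \in A i))%N.
  rewrite inE; case: forallP => [hA|/forallP].
    by rewrite big1 // => i _; have := hA i; rewrite mxE => ->.
  rewrite negb_forall => /existsP[i]; rewrite mxE => /negPf hi.
  by rewrite (bigD1 i) //= hi mul0n.
rewrite (eq_bigr _ (fun f _ => E f)) -(bigA_distr_bigA (fun i a => a \in A i : nat)).
apply: eq_bigr => i _; rewrite -sum1_card [RHS]big_mkcond /=.
by apply: eq_bigr => a _; case: (_ \in _).
Qed.

Definition upd x i (a : F) : pt := \row_l (if l == i then a else x 0 l).

(* Two points of the grid that differ in one coordinate are the only points of the
   grid where a suitable grid_fun is nonzero, so g vanishes at both or at
   neither of them. *)
Lemma grid_tight r g : r = (\sum_i (q - #|A i|))%N -> pfun r g ->
  (forall x, x \notin grid -> g x = 0) ->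
  forall p, p \in grid -> g p = 0 -> forall x, g x = 0.
Proof.
move=> rE gr gD p pD gp x; case: (boolP (x \in grid)) => [|/gD//].
move: {2}#|_| (erefl #|[set i | x 0 i != p 0 i]|) => k.
elim: k x => [|k IH] x hk xD.
  suff -> : x = p by [].
  apply/rowP => i; apply/eqP/negPn/negP => xi.
  by have := cards0_eq hk => /setP/(_ i); rewrite !inE xi.
have [i] : exists i, i \in [set i | x 0 i != p 0 i].
  by apply/set0Pn; rewrite -card_gt0 hk.
rewrite inE => xi.
have xA l : x 0 l \in A l by move: xD; rewrite inE => /forallP.
have pA l : p 0 l \in A l by move: pD; rewrite inE => /forallP.
pose v := upd x i (p 0 i).
have vD : v \in grid.
  by rewrite inE; apply/forallP => l; rewrite mxE; case: eqP => [->|].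
have gv : g v = 0.
  apply: IH vD; apply/eqP; rewrite -eqSS -hk (cardsD1 i [set i | x 0 i != p 0 i]) inE xi add1n eqSS.
  apply/eqP; apply: eq_card => l; rewrite !inE mxE; case: (eqVneq l i) => [->|_]; rewrite ?eqxx //.
(* Inside the grid, [grid_fun B] leaves x_i and p_i in direction i and only x_l in every other
   direction l; its degree, the sum of the #|A_l| - 1 minus 1, adds up with r to m (q - 1) - 1. *)
pose B l := if l == i then A i :\ x 0 i :\ p 0 i else A l :\ x 0 l.
apply: (pfun_pair _ gr (pfun_grid B) gD _ _ gv).
- have : (r + \sum_l #|B l| + 1)%N = (\sum_(l < m) q.-1)%N.
    rewrite rE -(eqP (_ : \sum_(l < m) (l == i : nat) == 1)%N); last first.
      by rewrite (bigD1 i) //= eqxx big1 ?addn0 // => l /negPf ->.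
    rewrite -!big_split; apply: eq_bigr => l _ /=; rewrite /B.
    have qA : (#|A l| <= q)%N by exact: max_card.
    have h1 := cardsD1 (x 0 l) (A l); rewrite xA in h1.
    case: (eqVneq l i) qA h1 => [->|_] qA h1.
      have h2 := cardsD1 (p 0 i) (A i :\ x 0 i); rewrite in_setD1 pA eq_sym xi in h2.
      have arith a b c Q : (a <= Q -> a = true + b -> b = true && true + c ->
        Q - a + c + true = Q.-1)%N by move=> /= *; lia.
      exact: arith qA h1 h2.
    have arith a b Q : (a <= Q -> a = true + b -> Q - a + b + false = Q.-1)%N.
      by move=> /= *; lia.
    exact: arith qA h1.
  rewrite sum_nat_const card_ord; lia.
- move=> y yD; rewrite grid_fun_neq0 => /forallP hy.
  have yA l : y 0 l \in A l by move: yD; rewrite inE => /forallP.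
  have yl l : l != i -> y 0 l = x 0 l.
    move=> li; apply/eqP/negPn/negP => yx; have := hy l.
    by rewrite /B (negPf li) in_setD1 yx yA.
  have := hy i; rewrite /B eqxx !in_setD1 yA andbT.
  case: (eqVneq (y 0 i) (x 0 i)) => [yi _|yi].
    left; apply/rowP => l; case: (eqVneq l i) => [->//|]; exact: yl.
  case: (eqVneq (y 0 i) (p 0 i)) => [yp _|] //.
  by right; apply/rowP => l; rewrite mxE; case: (eqVneq l i) => [->//|]; exact: yl.
- rewrite grid_fun_neq0; apply/forallP => l; rewrite /B.
  by case: (eqVneq l i) => [->|_]; rewrite !in_setD1 eqxx ?andbF.
Qed.

Lemma grid_compl x : (grid_fun (fun i => ~: A i) x != 0) = (x \in grid).
Proof.
by rewrite grid_fun_neq0 inE; apply: eq_forallb => i; rewrite inE negbK.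
Qed.

Lemma pfun_grid_compl : pfun (\sum_i (q - #|A i|))%N (grid_fun (fun i => ~: A i)).
Proof.
have := pfun_grid (fun i => ~: A i).
by congr pfun; apply: eq_bigr => i _; rewrite cardsCs setCK.
Qed.

End Grids.

End PolynomialFunctions.

(** * Circuits of different sizes *)

Section Circuits.
Variables (F : finFieldType) (m r : nat).
Local Notation q := #|F|.
Local Notation pt := 'rV[F]_m.

(** A minimal support of a nonzero codeword, with points in place of positions, so that their
    ordering stays out of the geometry. *)
Definition rm_circuit (D : {set pt}) : Prop :=
  [/\ D != set0,
      exists2 f, pfun r f & forall x, (f x != 0) = (x \in D)
    & forall g, pfun r g -> (forall x, x \notin D -> g x = 0) ->
      forall p, p \in D -> g p = 0 -> forall x, g x = 0].

Lemma grid_circuit (A : 'I_m -> {set F}) :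
  (forall i, (0 < #|A i|)%N) -> r = (\sum_i (q - #|A i|))%N -> rm_circuit (grid A).
Proof.
move=> A0 rE; split.
- rewrite -card_gt0 card_grid prodn_gt0 //.
- exists (grid_fun (fun i => ~: A i)); last exact: grid_compl.
  by rewrite rE; exact: pfun_grid_compl.
- by move=> g; exact: grid_tight.
Qed.

Lemma subset_of_card (T : finType) (B : {set T}) k :
  (k <= #|B|)%N -> exists2 A : {set T}, A \subset B & #|A| = k.
Proof.
move=> kT; exists [set x in take k (enum B)].
  by apply/subsetP => x; rewrite inE => /mem_take; rewrite mem_enum.
rewrite cardsE (card_uniqP _) ?take_uniq ?enum_uniq // size_take -cardE.
by case: ltngtP kT.
Qed.

Lemma grid_circuit_card (c : 'I_m -> nat) :
  (forall i, c i <= q.-1)%N -> r = (\sum_i c i)%N ->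
  exists2 D, rm_circuit D & #|D| = (\prod_i (q - c i))%N.
Proof.
move=> cq rE.
have q1 : (1 < q)%N := card_gt1 F.
have hA i : exists A : {set F}, #|A| = (q - c i)%N.
  have [|A _ hA] := @subset_of_card F setT (q - c i).
    by rewrite cardsT leq_subr.
  by exists A.
have [A AP] := fin_all_exists hA.
exists (grid A); last by rewrite card_grid; apply: eq_bigr => i _; rewrite AP.
apply: grid_circuit => [i|]; rewrite ?AP; first by have := cq i; lia.
by rewrite rE; apply: eq_bigr => i _; rewrite AP; have := cq i; lia.
Qed.

End Circuits.

Lemma sum_fill (k R m : nat) :
  (\sum_(0 <= i < m) minn k (R - i * k))%N = minn R (m * k).
Proof.
elim: m => [|m IH]; first by rewrite big_geq // mul0n minn0.
rewrite big_nat_recr //= IH mulSn; lia.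
Qed.

(** All coordinates but two get fixed sizes, and the remaining degree s is split as a + (s - a) over
    these two in two ways; with the sum fixed, the product (q - a) (q - s + a) changes with the
    unordered pair. *)
Lemma two_circuits_gt2 (F : finFieldType) (m r : nat) :
  (2 < #|F|)%N -> (1 < m)%N -> (2 <= r)%N -> (r + 2 <= m * #|F|.-1)%N ->
  exists D D' : {set 'rV[F]_m},
    [/\ rm_circuit r D, rm_circuit r D' & #|D| <> #|D'|].
Proof.
case: m => [|[|m]] // q3 _ r2 rm.
set q := #|F| in q3 rm *.
(* R is the degree spent greedily on the other coordinates, capped so that s >= 2. The bound s <= 2
   (q - 1) - 2 comes from that on r, or from q > 2 if s = 2. *)
pose R := minn (r - 2) (m * q.-1); pose s := (r - R)%N.
have rm' : (r + 2 <= q.-1 + (q.-1 + m * q.-1))%N by rewrite -!mulSn.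
have sR : (s + R = r)%N by rewrite /s /R; lia.
have s2 : (2 <= s)%N by rewrite /s /R; lia.
have sq : (s <= q.-1 + q.-1 - 2)%N by rewrite /s /R; lia.
have Rm : (R <= m * q.-1)%N by rewrite /R; lia.
pose c a (i : nat) := match i with 0 => a | 1 => (s - a)%N | k.+2 => minn q.-1 (R - k * q.-1) end.
have key a : (a <= q.-1)%N -> (s - a <= q.-1)%N -> (a <= s)%N ->
    exists2 D : {set 'rV[F]_m.+2}, rm_circuit r D &
      #|D| = ((q - a) * ((q - (s - a)) *
              \prod_(0 <= i < m) (q - minn q.-1 (R - i * q.-1))))%N.
  move=> aq saq sa.
  have [||D hD Dc] := @grid_circuit_card F m.+2 r (fun i => c a i).
  - by move=> [[|[|k]] hk] //=; exact: geq_minl.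
  - rewrite -(big_mkord xpredT (c a)) !big_nat_recl //= sum_fill; lia.
  - exists D => //.
    by rewrite Dc -(big_mkord xpredT (fun i => (q - c a i)%N)) !big_nat_recl.
set Pr := (\prod_(0 <= i < m) _)%N in key.
have Pr0 : (0 < Pr)%N by rewrite prodn_gt0 // => i; lia.
have main a b : (a <= q.-1)%N -> (s - a <= q.-1)%N -> (a <= s)%N ->
    (b <= q.-1)%N -> (s - b <= q.-1)%N -> (b <= s)%N ->
    ((q - a) * (q - (s - a)) != (q - b) * (q - (s - b)))%N ->
  exists D D' : {set 'rV[F]_m.+2}, [/\ rm_circuit r D, rm_circuit r D' & #|D| <> #|D'|].
  move=> a1 a2 a3 b1 b2 b3 ab.
  have [D hD Dc] := key a a1 a2 a3; have [D' hD' Dc'] := key b b1 b2 b3.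
  exists D, D'; split=> //; rewrite Dc Dc' !mulnA => /eqP.
  by rewrite eqn_pmul2r // (negPf ab).
(* The values of a are s and s - 1 if s fits into one coordinate, q - 1 and q - 2 otherwise; 2 <= s
   <= 2 q - 4 makes the products differ. *)
case: (leqP s q.-1) => sq1.
  by apply: (main s s.-1); lia.
by apply: (main q.-1 q.-2); lia.
Qed.

Lemma sum_ord_between (a b m : nat) : (b <= m)%N ->
  (\sum_(i < m) ((a <= i) && (i < b))%N = b - a)%N.
Proof.
move=> bm; have -> : (b - a = minn m b - a)%N by lia.
elim: m {bm} => [|m IH]; first by rewrite big_ord0 min0n.
rewrite big_ord_recr /= IH; case: (leqP a m); case: (ltnP m b) => /=; lia.
Qed.

(** * The quadric over the field with two elements *)

Section BinaryQuadric.
Variables (F : finFieldType) (m r : nat).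
Hypotheses (q2 : #|F| = 2%N) (r2 : (2 <= r)%N) (rm : (r + 2 <= m)%N).
Local Notation pt := 'rV[F]_m.
Local Notation b4 := (bool * bool * bool * bool)%type.
Implicit Types (x y p : pt) (a b c : b4).

Lemma F2E (t : F) : t = (t == 1)%:R.
Proof.
have /setP/(_ t) : [set 0; 1 : F] = setT.
  by apply/eqP; rewrite eqEcard subsetT cardsT q2 cards2 eq_sym oner_neq0.
by rewrite !inE => /orP[] /eqP ->; rewrite ?eqxx // eq_sym oner_eq0.
Qed.

Lemma F2D (s t : bool) : s%:R + t%:R = (s (+) t)%:R :> F.
Proof.
case: s t => [] [] /=; rewrite ?addr0 ?add0r //.
rewrite [LHS]F2E; case: eqP => //= /eqP.
by rewrite -subr_eq0 addrK oner_eq0.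
Qed.

Lemma F2M (s t : bool) : s%:R * t%:R = (s && t)%:R :> F.
Proof. by case: s t => [] [] /=; rewrite ?mulr0 ?mul0r ?mulr1. Qed.

Lemma F2_eq0 (s : bool) : (s%:R == 0 :> F) = ~~ s.
Proof. by case: s; rewrite ?eqxx ?oner_eq0. Qed.

Lemma F2_same (s t : F) : s + t + 1 != 0 -> s = t.
Proof.
rewrite (F2E s) (F2E t) -[1]/(true%:R) !F2D F2_eq0 negbK.
by case: (s == 1); case: (t == 1).
Qed.

Lemma F2_or (s t u : F) : s != t -> u = s \/ u = t.
Proof.
rewrite (F2E s) (F2E t) (F2E u).
by case: (s == 1); case: (t == 1); case: (u == 1); rewrite ?eqxx //; [left|right|right|left].
Qed.

Lemma m_gt k : (k < 4)%N -> (k < m)%N. Proof. by lia. Qed.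
Local Notation o k := (@Ordinal m k (m_gt (isT : (k < 4)%N))).

Definition bits x : b4 :=
  (x 0 (o 0) == 1, x 0 (o 1) == 1, x 0 (o 2) == 1, x 0 (o 3) == 1).

Definition sub_bits x a : pt := let: (a0, a1, a2, a3) := a in
  \row_(i < m) match val i with
    | 0 => a0%:R | 1 => a1%:R | 2 => a2%:R | 3 => a3%:R | _ => x 0 i end.

Arguments sub_bits : simpl never.

Lemma sub_bits_eq x y : (forall i : 'I_m, (3 < i)%N -> y 0 i = x 0 i) ->
  y = sub_bits x (bits y).
Proof.
move=> h; apply/rowP => -[[|[|[|[|k]]]] hk]; rewrite mxE /=; last by rewrite h.
all: by rewrite [LHS]F2E; congr ((y 0 _ == 1)%:R); apply: val_inj.
Qed.

Arguments bits : simpl never.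

Lemma bits_sub x a : bits (sub_bits x a) = a.
Proof.
case: a => [[[a0 a1] a2] a3]; rewrite /bits !mxE /=.
have h (s : bool) : (s%:R == 1 :> F) = s by case: s; rewrite ?eqxx // eq_sym oner_eq0.
by rewrite !h.
Qed.

Lemma sub_bits_high x a (i : 'I_m) : (3 < i)%N -> sub_bits x a 0 i = x 0 i.
Proof. by case: a i => [[[a0 a1] a2] a3] [[|[|[|[|k]]]] hk] //= _; rewrite mxE. Qed.

Definition on_quadric a : bool := let: (a0, a1, a2, a3) := a in (a0 && a1) (+) (a2 && a3).

Definition high_ones x := forall i : 'I_m, (4 <= i)%N && (i < r.+2)%N -> x 0 i = 1.

(* On the support, x0 x1 + x2 x3 = 1, the coordinates 4, ..., r + 1 are equal to 1
   and the later ones are free. *)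
Definition quadric x : F :=
  (x 0 (o 0) * x 0 (o 1) + x 0 (o 2) * x 0 (o 3)) *
  \prod_(i < m) (if (4 <= i)%N && (i < r.+2)%N then x 0 i else 1).

Lemma quadric_neq0 x : quadric x != 0 <-> on_quadric (bits x) /\ high_ones x.
Proof.
rewrite /quadric mulf_eq0 negb_or; split.
  move=> /andP[h1 /prodf_neq0 h2]; split.
    move: h1; rewrite [x 0 (o 0)]F2E [x 0 (o 1)]F2E [x 0 (o 2)]F2E [x 0 (o 3)]F2E.
    by rewrite !F2M F2D F2_eq0 negbK.
  move=> i hi; have := h2 i isT; rewrite hi {1}[x 0 i]F2E F2_eq0 negbK.
  by move=> /eqP.
move=> [h1 h2]; apply/andP; split.
  rewrite [x 0 (o 0)]F2E [x 0 (o 1)]F2E [x 0 (o 2)]F2E [x 0 (o 3)]F2E.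
  by rewrite !F2M F2D F2_eq0 negbK.
by apply/prodf_neq0 => i _; case: ifP => [/h2 ->|_]; rewrite oner_eq0.
Qed.

Lemma pfun_if_prod (P : pred 'I_m) (h : 'I_m -> pt -> F) :
  (forall i, pfun 1 (h i)) ->
  pfun (\sum_i P i)%N (fun x => \prod_i (if P i then h i x else 1)).
Proof.
move=> hh; apply: (@pfun_prod F m _ _ xpredT (fun i => P i : nat) (fun i x => if P i then h i x else 1)).
by move=> i _; case: (P i); [exact: hh | exact: pfun_cst].
Qed.

Lemma pfun_quadric : pfun r quadric.
Proof.
have -> : r = (2 + \sum_(i < m) ((4 <= i) && (i < r.+2))%N)%N.
  by rewrite sum_ord_between; lia.
apply: pfunM; last exact: pfun_if_prod (fun i => pfun_coord F i).
by apply: pfunD; exact: (pfunM (pfun_coord F _) (pfun_coord F _)).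
Qed.

Definition quadric_pts : {set pt} := [set x | quadric x != 0].

Section Tight.
Variable g : pt -> F.
Hypotheses (gr : pfun r g) (gD : forall x, x \notin quadric_pts -> g x = 0).

(** Nonvanishing of the affine form 1 + a0 b0 + a1 b1 + a2 b2 + a3 b3. *)
Definition parity_form a : b4 -> bool := let: (a0, a1, a2, a3) := a in
  fun b => let: (b0, b1, b2, b3) := b in
  ~~ ((a0 && b0) (+) (a1 && b1) (+) (a2 && b2) (+) (a3 && b3)).

(* The affine form with coefficients c, times the indicator function of the free
   coordinates of x, meets the support in at most the two points a and b. *)
Lemma quadric_edge c a b x : high_ones x ->
  (forall e, on_quadric e -> parity_form c e -> e = a \/ e = b) -> parity_form c a ->
  g (sub_bits x b) = 0 -> g (sub_bits x a) = 0.
Proof.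
case: c => [[[c0 c1] c2] c3] gx hab ca.
pose l y : F := c0%:R * y 0 (o 0) + c1%:R * y 0 (o 1) + c2%:R * y 0 (o 2) + c3%:R * y 0 (o 3) + 1.
(* Its degree is 1 plus one for each of the m - r - 2 free coordinates, that is m - 1 - r, the
   largest that [pfun_pair] admits. *)
pose h y : F := l y * \prod_(i < m) (if (r.+2 <= i)%N && (i < m)%N then y 0 i + x 0 i + 1 else 1).
have lE y : (l y != 0) = parity_form (c0, c1, c2, c3) (bits y).
  rewrite /l [y 0 (o 0)]F2E [y 0 (o 1)]F2E [y 0 (o 2)]F2E [y 0 (o 3)]F2E.
  rewrite -[1 in X in X != 0]/(true%:R) !F2M !F2D F2_eq0 negbK /=.
  by rewrite addbT.
have hpf : pfun (1 + \sum_(i < m) ((r.+2 <= i) && (i < m))%N) h.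
  apply: pfunM; last first.
    apply: (@pfun_if_prod (fun i : 'I_m => (r.+2 <= i) && (i < m))%N (fun i y => y 0 i + x 0 i + 1)).
    by move=> i; apply: (eq_pfun _ (pfun_lin i (x 0 i + 1))) => w; rewrite addrA.
  have hc (t : bool) k : pfun 1 (fun y : pt => t%:R * y 0 k) by apply: pfunZ (pfun_coord _ _).
  by do !apply: pfunD; rewrite ?hc //; exact: pfun_cst.
apply: (pfun_pair _ gr hpf gD).
- rewrite sum_ord_between // q2; lia.
- move=> y; rewrite inE => /quadric_neq0[yq yg]; rewrite mulf_eq0 negb_or lE.
  move=> /andP[/(hab _ yq) hb /prodf_neq0 hy].
  have yx (i : 'I_m) : (3 < i)%N -> y 0 i = x 0 i.
    move=> i3; case: (ltnP i r.+2) => ir; first by rewrite yg ?gx ?i3.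
    by have := hy i isT; rewrite ir ltn_ord => /F2_same.
  by case: hb => <-; [left|right]; exact: sub_bits_eq.
rewrite mulf_eq0 negb_or lE bits_sub ca; apply/prodf_neq0 => i _.
case: ifP => [/andP[ir _]|_]; last by rewrite oner_eq0.
rewrite sub_bits_high; last lia.
by rewrite [x 0 i]F2E F2D addbb add0r oner_eq0.
Qed.

Local Notation origin := (false, false, true, true).

(** The quadric has six points in four bits, and the five affine forms used, each nonzero at exactly
    two of them, give the edges of a spanning tree. *)
Lemma quadric_bits_connected x a b : high_ones x -> on_quadric a -> on_quadric b ->
  g (sub_bits x b) = 0 -> g (sub_bits x a) = 0.
Proof.
move=> gx.
have E c e e' : (forall z, on_quadric z -> parity_form c z -> z = e \/ z = e') ->
    parity_form c e -> parity_form c e' -> (g (sub_bits x e) = 0 <-> g (sub_bits x e') = 0).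
  move=> h he he'; split; last exact: quadric_edge h he.
  by apply: (quadric_edge gx (c := c)) he' => z zq zc; case: (h z zq zc); [right|left].
have E1 := E (true,false,false,false) origin (false,true,true,true).
have E2 := E (false,true,false,false) origin (true,false,true,true).
have E3 := E (true,false,true,false) (true,true,true,false) (true,false,true,true).
have E4 := E (false,false,false,true) (true,true,true,false) (true,true,false,false).
have E5 := E (false,false,true,false) (true,true,false,true) (true,true,false,false).
have {}E1 : g (sub_bits x origin) = 0 <-> g (sub_bits x (false,true,true,true)) = 0.
  by apply: E1 => // -[[[[] []] []] []] //= _ _; [right|left].
have {}E2 : g (sub_bits x origin) = 0 <-> g (sub_bits x (true,false,true,true)) = 0.
  by apply: E2 => // -[[[[] []] []] []] //= _ _; [right|left].
have {}E3 : g (sub_bits x (true,true,true,false)) = 0 <-> g (sub_bits x (true,false,true,true)) = 0.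
  by apply: E3 => // -[[[[] []] []] []] //= _ _; [left|right].
have {}E4 : g (sub_bits x (true,true,true,false)) = 0 <-> g (sub_bits x (true,true,false,false)) = 0.
  by apply: E4 => // -[[[[] []] []] []] //= _ _; [left|right].
have {}E5 : g (sub_bits x (true,true,false,true)) = 0 <-> g (sub_bits x (true,true,false,false)) = 0.
  by apply: E5 => // -[[[[] []] []] []] //= _ _; [left|right].
by move: a b => [[[[] []] []] []] [[[[] []] []] []] //= _ _; tauto.
Qed.

(** Among the six points only [origin] has its first two bits 0. The factor (x_0 + 1) (x_1 + 1)
    isolates it at degree 2, one more than an affine form, which is paid for by leaving the
    coordinate l free. *)
Lemma quadric_switch x y (l : 'I_m) : high_ones x -> (r.+2 <= l)%N -> y 0 l != x 0 l ->
  (forall i, i != l -> y 0 i = x 0 i) ->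
  g (sub_bits y origin) = 0 -> g (sub_bits x origin) = 0.
Proof.
move=> gx lr yl yx.
pose h (z : pt) : F := (z 0 (o 0) + 1) * (z 0 (o 1) + 1) *
  \prod_(i < m) (if (r.+2 <= i)%N && (i != l) then z 0 i + x 0 i + 1 else 1).
have hpf : pfun (1 + 1 + \sum_(i < m) ((r.+2 <= i) && (i != l))%N) h.
  apply: pfunM; first by apply: pfunM; exact: pfun_lin.
  apply: (@pfun_if_prod (fun i : 'I_m => (r.+2 <= i) && (i != l))%N (fun i z => z 0 i + x 0 i + 1)).
  by move=> i; apply: (eq_pfun _ (pfun_lin i (x 0 i + 1))) => w; rewrite addrA.
have h01 (z : pt) : ((z 0 (o 0) + 1) * (z 0 (o 1) + 1) != 0) =
    ~~ (z 0 (o 0) == 1) && ~~ (z 0 (o 1) == 1).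
  rewrite [z 0 (o 0) in LHS]F2E [z 0 (o 1) in LHS]F2E -[1 in X in X != 0]/(true%:R) !F2D F2M F2_eq0 negbK.
  by rewrite !addbT.
apply: (pfun_pair _ gr hpf gD).
- have : (\sum_(i < m) ((r.+2 <= i) && (i != l))%N + 1 = m - r.+2)%N.
    rewrite -(sum_ord_between r.+2 (leqnn m)).
    rewrite -(eqP (_ : \sum_(i < m) (i == l : nat) == 1)%N); last first.
      by rewrite (bigD1 l) //= eqxx big1 ?addn0 // => i /negPf ->.
    rewrite -big_split; apply: eq_bigr => i _ /=; rewrite ltn_ord andbT.
    by case: (eqVneq i l) => [->|_]; rewrite ?lr ?andbF ?andbT ?addn0.
  by rewrite q2; lia.
- move=> z; rewrite inE => /quadric_neq0[zq zg]; rewrite mulf_eq0 negb_or h01.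
  move=> /andP[/andP[z0 z1] /prodf_neq0 hz].
  have zx (i : 'I_m) : (3 < i)%N -> i != l -> z 0 i = x 0 i.
    move=> i3 il; case: (ltnP i r.+2) => ir; first by rewrite zg ?gx ?i3.
    by have := hz i isT; rewrite ir il => /F2_same.
  have zb : bits z = origin.
    move: zq; rewrite /bits (negPf z0) (negPf z1) /=.
    by case: (_ == 1); case: (_ == 1).
  case: (F2_or (z 0 l) yl) => zl; [right|left]; rewrite -zb;
    apply: sub_bits_eq => i i3; case: (eqVneq i l) => [->//|il]; rewrite zx ?yx //.
rewrite mulf_eq0 negb_or h01; apply/andP; split.
  by case: (bits_sub x origin) => -> ->.
apply/prodf_neq0 => i _; case: ifP => [/andP[ir _]|_]; last by rewrite oner_eq0.
rewrite sub_bits_high; last lia.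
by rewrite [x 0 i]F2E F2D addbb add0r oner_eq0.
Qed.

Lemma quadric_tight p : p \in quadric_pts -> g p = 0 -> forall x, g x = 0.
Proof.
rewrite inE => /quadric_neq0[pq pg] gp x.
case: (boolP (x \in quadric_pts)) => [|/gD//]; rewrite inE => /quadric_neq0[xq xg].
have self y : y = sub_bits y (bits y) by apply: sub_bits_eq.
rewrite [x]self; apply: (quadric_bits_connected (b := origin)) => //.
move: {2}#|_| (erefl #|[set i : 'I_m | (r.+2 <= i)%N && (x 0 i != p 0 i)]|) => k.
elim: k x xg {xq} => [|k IH] x xg hk.
  have -> : sub_bits x origin = sub_bits p origin.
    rewrite [LHS](@sub_bits_eq p) ?bits_sub // => i i3; rewrite sub_bits_high //.
    case: (ltnP i r.+2) => ir; first by rewrite xg ?pg ?i3.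
    by have := cards0_eq hk => /setP/(_ i); rewrite !inE ir => /negbFE/eqP.
  by apply: (quadric_bits_connected (b := bits p)) => //; rewrite -self.
have [l] : exists l, l \in [set i : 'I_m | (r.+2 <= i)%N && (x 0 i != p 0 i)].
  by apply/set0Pn; rewrite -card_gt0 hk.
rewrite inE => /andP[lr xl].
pose y := upd x l (p 0 l).
have yi i : i != l -> y 0 i = x 0 i by move=> il; rewrite mxE (negPf il).
have yl : y 0 l = p 0 l by rewrite mxE eqxx.
apply: (quadric_switch (y := y) xg lr) => //; first by rewrite yl eq_sym.
apply: IH.
  move=> i hi; rewrite yi ?xg //; apply: contraTneq hi => ->; lia.
apply/eqP; rewrite -eqSS -hk (cardsD1 l [set i : 'I_m | (r.+2 <= i)%N && (x 0 i != p 0 i)]) inE lr xl add1n eqSS.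
apply/eqP; apply: eq_card => i; rewrite !inE.
by case: (eqVneq i l) => [->|il]; rewrite ?yl ?eqxx ?andbF // yi.
Qed.

End Tight.

Lemma quadric_circuit : rm_circuit r quadric_pts.
Proof.
split.
- apply/set0Pn; exists (sub_bits (const_mx 1) (true, true, false, false)).
  rewrite inE; apply/quadric_neq0; rewrite bits_sub; split=> // i /andP[i3 _].
  by rewrite sub_bits_high // mxE.
- by exists quadric => [|x]; [exact: pfun_quadric | rewrite inE].
- by move=> g gr gD p pD gp x; exact: quadric_tight pD gp x.
Qed.

(* Clearing one bit of the points with first bits 1111 embeds the grid
   x2 = x3 = x4 = ... = 1 as a proper subset of the quadric. *)
Lemma two_circuits_2 : exists D D' : {set pt},
  [/\ rm_circuit r D, rm_circuit r D' & #|D| <> #|D'|].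
Proof.
pose A (i : 'I_m) : {set F} := if (2 <= i)%N && (i < r.+2)%N then [set 1] else setT.
exists (grid A), quadric_pts; split; last 1 first.
- have GP x : x \in grid A -> exists a0 a1 : bool, bits x = (a0, a1, true, true) /\ high_ones x.
    rewrite inE => /forallP xA.
    have x1 (i : 'I_m) : (2 <= i)%N && (i < r.+2)%N -> x 0 i = 1.
      by move=> hi; have := xA i; rewrite /A hi inE => /eqP.
    exists (x 0 (o 0) == 1), (x 0 (o 1) == 1); split.
      by rewrite /bits (x1 (o 2)) ?(x1 (o 3)) ?eqxx //=; lia.
    move=> i hi; apply: x1; lia.
  (* w lies on the quadric and is missed by f, whose values on the grid have first bits 0011, 0111,
     1011 or 1101. *)
  pose w : pt := sub_bits (const_mx 1) (true, true, true, false).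
  pose f x := if (bits x).1.1 == (true, true) then sub_bits x (true, true, false, true) else x.
  have fD x : x \in grid A -> f x \in quadric_pts :\ w.
    move=> /GP[a0 [a1 [xb xg]]]; rewrite !inE /f /w xb /=.
    case: (eqVneq (a0, a1) (true, true)) => [_|h].
      apply/andP; split; first by apply/eqP => /(congr1 bits); rewrite !bits_sub.
      apply/quadric_neq0; rewrite bits_sub; split=> // i hi.
      by rewrite sub_bits_high ?xg //; lia.
    apply/andP; split.
      by apply/eqP => /(congr1 bits); rewrite xb bits_sub.
    apply/quadric_neq0; rewrite xb; split=> //.
    by move: h; case: a0 {xb}; case: a1.
  have finj : {in grid A &, injective f}.
    move=> x y /GP[a0 [a1 [xb xg]]] /GP[b0 [b1 [yb yg]]]; rewrite /f xb yb /=.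
    case: (eqVneq (a0, a1) (true, true)) => [ha|ha]; case: (eqVneq (b0, b1) (true, true)) => [hb|hb] //.
    + move=> E; rewrite [y](@sub_bits_eq x) ?yb.
        by rewrite {1}[x](@sub_bits_eq x) // xb; case: ha hb => -> -> [-> ->].
      by move=> i i3; have := congr1 (fun z : pt => z 0 i) E; rewrite !sub_bits_high.
    + by move=> /(congr1 bits); rewrite yb bits_sub.
    + by move=> /(congr1 bits); rewrite xb bits_sub.
  have h : (#|grid A| <= #|quadric_pts :\ w|)%N.
    rewrite -(card_in_imset finj); apply/subset_leq_card/subsetP => y /imsetP[x xG ->].
    exact: fD.
  have e : w \in quadric_pts.
    rewrite inE /w; apply/quadric_neq0; rewrite bits_sub; split=> // i /andP[i3 _].
    by rewrite sub_bits_high // mxE.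
  have E1 := cardsD1 w quadric_pts; rewrite e in E1 => E.
  by move: h; rewrite E E1 add1n ltnn.
- apply: grid_circuit => [i|]; rewrite /A; first by case: ifP; rewrite ?cards1 ?cardsT ?q2.
  rewrite -[LHS](_ : r.+2 - 2 = r)%N; last lia.
  rewrite -(sum_ord_between 2 (_ : r.+2 <= m)%N); last lia.
  by apply: eq_bigr => i _; case: ifP; rewrite ?cards1 ?cardsT q2.
exact: quadric_circuit.
Qed.

End BinaryQuadric.

(** * Purity of Reed-Muller codes *)

(** By [nullity_uniform] a set of positive nullity has nu + rho elements; a coloop-free set of
    nullity 0 is empty. *)
Lemma uniform_equicardinal n (nu : {set 'I_n} -> nat) rho :
  nullity nu -> (forall W : {set 'I_n}, (nu W == 0%N) = (#|W| <= rho)%N) ->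
  forall S T, coloop_free nu S -> coloop_free nu T -> nu S = nu T -> #|S| = #|T|.
Proof.
move=> nuP hr S T cS cT hST.
have nuE := nullity_uniform nuP hr.
have c0 (U : {set 'I_n}) : coloop_free nu U -> nu U = 0%N -> #|U| = 0%N.
  move=> cU U0; apply/eqP; rewrite cards_eq0; apply/set0Pn => -[e /cU].
  by rewrite U0.
case: (posnP (nu S)) => [S0|Sp].
  by rewrite !c0 // -hST.
by move: Sp hST; rewrite !nuE; lia.
Qed.

(* The fibres of phi are permuted transitively by the translations tau t. *)
Lemma equidistributed (F : finFieldType) (X : finType) (A : {set X})
    (phi : X -> F) (tau : F -> X -> X) :
  (forall t, injective (tau t)) -> (forall t x, x \in A -> tau t x \in A) ->
  (forall t x, x \in A -> phi (tau t x) = phi x + t) ->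
  (#|F| * #|[set x in A | phi x != 0%R]| = #|F|.-1 * #|A|)%N.
Proof.
move=> tinj tA tphi.
pose Z t := [set x in A | phi x == t].
have leZ t u : (#|Z t| <= #|Z u|)%N.
  rewrite -(card_imset _ (tinj (u - t))); apply/subset_leq_card/subsetP => y.
  move=> /imsetP[x]; rewrite !inE => /andP[xA /eqP xt] ->.
  by rewrite tA // tphi // xt subrKC eqxx.
have eqZ t : #|Z t| = #|Z 0%R| by apply/eqP; rewrite eqn_leq !leZ.
have cA : #|A| = (#|F| * #|Z 0%R|)%N.
  rewrite -sum1_card (partition_big phi xpredT) //= -sum_nat_const.
  apply: eq_bigr => t _; rewrite -(eqZ t) -sum1_card.
  by apply: eq_bigl => x; rewrite inE.
have : #|A| = (#|Z 0%R| + #|[set x in A | phi x != 0%R]|)%N.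
  rewrite -(cardsID (Z 0) A); congr (_ + _)%N; apply: eq_card => x; rewrite !inE.
    by case: (x \in A).
  by case: (x \in A); rewrite ?andbF ?andbT.
move=> E; have -> : #|[set x in A | phi x != 0%R]| = (#|F|.-1 * #|Z 0%R|)%N.
  apply/eqP; rewrite -(eqn_add2l #|Z 0%R|) -E cA -mulSn prednK //.
  by have := card_gt1 F; lia.
by rewrite cA mulnCA.
Qed.

Section ReedMuller.
Variables (F : finFieldType) (m r N : nat) (P : 'I_N -> 'rV[F]_m).
Variable C : {vspace 'rV[F]_N}.
Hypotheses (hP : bijective P) (hC : is_reed_muller r P C).
Variable H : 'M[F]_(N - \dim C, N).
Hypothesis hH : parity_check H.
Local Notation q := #|F|.
Local Notation pt := 'rV[F]_m.
Local Notation nu := (code_nullity C).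
Implicit Types (x y u v z p : pt).

Lemma card_points (D : {set pt}) : #|P @^-1: D| = #|D|.
Proof. by apply: on_card_preimset; apply: onW_bij. Qed.

Lemma rm_circuit_face (D : {set pt}) : rm_circuit r D ->
  ~~ code_face H (P @^-1: D) /\
  (forall e, e \in P @^-1: D -> code_face H (P @^-1: D :\ e)).
Proof.
move=> [D0 [f fr fD] tight]; have faceE := code_faceE hH.
have [Q PK QK] := hP.
split.
  rewrite faceE; apply/code_nullity0P => h.
  have /set0Pn[x xD] := D0.
  have : \row_j f (P j) = 0.
    apply: h; first exact: mem_reed_muller hC fr.
    by move=> j; rewrite mxE inE -fD negbK => /eqP.
  by move/rowP/(_ (Q x)); rewrite !mxE QK => E; rewrite -fD E eqxx in xD.
move=> e; rewrite inE => eD; rewrite faceE; apply/code_nullity0P => c cC hc.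
have [g gr cg] := reed_muller_pfun hC cC.
have gz x : P e = x \/ x \notin D -> g x = 0.
  move=> h; rewrite -(QK x) -cg hc // !inE negb_and negbK; case: h => [<-|xD].
    by rewrite PK eqxx.
  by rewrite QK xD orbT.
apply/rowP => j; rewrite cg mxE; apply: (tight g gr _ (P e) eD).
  by move=> x xD; apply: gz; right.
by apply: gz; left.
Qed.

Lemma rm_circuits_equal (D D' : {set pt}) :
  (forall E : free_seq F N,
    minimal_graded_resolution (\dim C) (sr_ideal (code_face H)) E ->
    pure (\dim C) E) ->
  rm_circuit r D -> rm_circuit r D' -> #|D| = #|D'|.
Proof.
move=> hpure /rm_circuit_face[D1 D2] /rm_circuit_face[D1' D2'].
by rewrite -card_points -[RHS]card_points; apply: equal_circuits_of_pure hpure _ _ _ _.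
Qed.

Definition equicardinal : Prop := forall S T,
  coloop_free nu S -> coloop_free nu T -> nu S = nu T -> #|S| = #|T|.

(** The two conditions make the matroid uniform: supports of nonzero words have more than rho
    points, and every set of rho + 1 points contains one. *)
Lemma equicardinal_uniform rho :
  (forall g (D : {set pt}), pfun r g -> (forall x, x \notin D -> g x = 0) ->
     (#|D| <= rho)%N -> forall x, g x = 0) ->
  (forall D : {set pt}, #|D| = rho.+1 -> exists g,
     [/\ pfun r g, forall x, x \notin D -> g x = 0 & exists x, g x != 0]) ->
  equicardinal.
Proof.
move=> low high; apply: (@uniform_equicardinal N nu rho); first exact: code_nullityP.
have [Q PK QK] := hP.
move=> W; case: leqP => hW.
  apply/code_nullity0P => c cC hc; have [g gr cg] := reed_muller_pfun hC cC.
  apply/rowP => j; rewrite cg mxE; apply: (low g (P @: W) gr).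
    move=> x xW; rewrite -(QK x) -cg hc //; apply: contra xW => QW.
    by rewrite -(QK x) imset_f.
  by rewrite card_imset //; exact: bij_inj.
apply/negbTE/negP => /code_nullity0P h.
have [W' sW cW] := subset_of_card hW.
have [|g [gr gD [x gx]]] := high (P @: W').
  by rewrite card_imset //; exact: bij_inj.
have : \row_j g (P j) = 0.
  apply: h; first exact: mem_reed_muller hC gr.
  move=> j jW; rewrite mxE; apply: gD.
  by apply: contra jW => /imsetP[j' jW' /(bij_inj hP) ->]; exact: (subsetP sW).
by move/rowP/(_ (Q x)); rewrite !mxE QK => E; rewrite E eqxx in gx.
Qed.

(** A Reed-Solomon code, of minimum distance q - r. The product of the y - a over the points a of D
    other than x is the test function isolating x; the product over the complement of D is a word
    supported in D. *)
Lemma equicardinal_m1 : m = 1%N -> (r <= q.-1)%N -> equicardinal.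
Proof.
move=> m1 rq; have q1 := card_gt1 F.
have mq : (m * q.-1 = q.-1)%N by rewrite m1 mul1n.
have i0 : 'I_m by rewrite m1; exact: ord0.
have iE (i : 'I_m) : i = i0 by apply: val_inj; case: i i0 => [a ha] [b hb] /=; lia.
have cpt : #|{: pt}| = q by rewrite card_mx m1 mul1n expn1.
apply: (@equicardinal_uniform (q.-1 - r)).
  move=> g D gr gD Dq x; case: (boolP (x \in D)) => [xD|/gD//].
  pose h y := \prod_(a in D :\ x) (y 0 i0 + - a 0 i0).
  have hpf : pfun (\sum_(a in D :\ x) 1)%N h.
    by apply: pfun_prod => a _; exact: pfun_lin.
  apply: (@pfun_point F m r _ g h x _ gr hpf).
  - have arith d e k : (d <= k - r -> d = true + e -> r <= k -> r + e < k)%N.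
      by move=> /= *; lia.
    rewrite mq sum1_card; apply: (arith _ _ _ Dq _ rq).
    by rewrite (cardsD1 x D) xD.
  - move=> y yx; case: (boolP (y \in D)) => [yD|/gD ->]; last by rewrite mul0r.
    by rewrite /h (bigD1 y) ?in_setD1 ?yx //= subrr mul0r mulr0.
  - apply/prodf_neq0 => a; rewrite in_setD1 => /andP[ax _]; rewrite subr_eq0.
    by apply: contra ax => /eqP h1; apply/eqP/rowP => i; rewrite (iE i).
move=> D cD; exists (fun y => \prod_(a in ~: D) (y 0 i0 + - a 0 i0)); split.
- have : pfun (\sum_(a in ~: D) 1)%N (fun y => \prod_(a in ~: D) (y 0 i0 + - a 0 i0)).
    by apply: pfun_prod => a _; exact: pfun_lin.
  apply: pfun_leq; rewrite sum1_card cardsCs setCK cpt cD; lia.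
- by move=> x xD; rewrite (bigD1 x) ?inE //= subrr mul0r.
- have [x xD] : exists x, x \in D by apply/set0Pn; rewrite -card_gt0 cD.
  exists x; apply/prodf_neq0 => a; rewrite inE subr_eq0 => aD.
  by apply: contra aD => /eqP h1; rewrite (_ : a = x) //; apply/rowP => i; rewrite (iE i).
Qed.

Lemma equicardinal_0 : r = 0%N -> equicardinal.
Proof.
move=> r0; have pt0 : (0 < #|{: pt}|)%N by rewrite card_mx expn_gt0 (ltnW (card_gt1 F)).
apply: (@equicardinal_uniform #|{: pt}|.-1).
  move=> g D [f fr fg] gD Dq x.
  have gc y : g y = \sum_(k <- msupp f) f@_k.
    rewrite fg mevalE; apply: eq_big_seq => k /fr; rewrite r0 leqn0 mdeg_eq0 => /eqP ->.
    by rewrite big1 ?mulr1 // => i _; rewrite mnm0E expr0.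
  have [y yD] : exists y, y \notin D.
    apply/existsP; apply: contraLR Dq; rewrite negb_exists => /forallP DT.
    have -> : D = setT by apply/setP => y; rewrite inE; have := DT y; rewrite negbK.
    by rewrite cardsT -ltnNge prednK.
  by rewrite (gc x) -(gc y) (gD _ yD).
move=> D cD; exists (fun _ => 1); split; first exact: pfun_cst.
  move=> x; suff -> : D = setT by rewrite inE.
  apply/eqP; rewrite eqEcard subsetT cardsT cD prednK //= leqnn.
by exists 0; rewrite oner_eq0.
Qed.

Lemma grid_set1 u : grid (fun i => [set u 0 i]) = [set u].
Proof.
apply/setP => x; rewrite !inE; apply/forallP/eqP => [h|-> i]; last by rewrite inE.
by apply/rowP => i; have := h i; rewrite inE => /eqP.
Qed.

(** Indicator functions of points have degree m (q - 1), so the code is the whole space and rho is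
    0. *)
Lemma equicardinal_top : r = (m * q.-1)%N -> equicardinal.
Proof.
move=> rE; apply: (@equicardinal_uniform 0).
  by move=> g D gr gD; rewrite leqn0 cards_eq0 => /eqP D0 x; rewrite gD // D0 inE.
move=> D /eqP/cards1P[u ->].
exists (grid_fun (fun i => ~: [set u 0 i])); split.
- have := pfun_grid_compl (fun i : 'I_m => [set u 0 i]).
  under eq_bigr do rewrite cards1; by rewrite sum_nat_const card_ord rE subn1.
- move=> x; rewrite -grid_set1; apply: contraNeq; by rewrite grid_compl.
- by exists u; rewrite grid_compl grid_set1 inE.
Qed.

(** One goes from u to v changing one coordinate at a time. If u and w differ in one coordinate, the
    grid with points u and w carries a function of degree m (q - 1) - 1, and its two values are
    opposite because they sum to zero. *)
Lemma pfun_delta_diff u v : r.+1 = (m * q.-1)%N ->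
  pfun r (fun x => (x == u)%:R - (x == v)%:R).
Proof.
move=> rE; have q1 := card_gt1 F.
move: {2}#|_| (erefl #|[set i | u 0 i != v 0 i]|) => k.
elim: k u => [|k IH] u hk.
  have -> : u = v.
    apply/rowP => i; apply/eqP/negPn/negP => xi.
    by have := cards0_eq hk => /setP/(_ i); rewrite !inE xi.
  by apply: (eq_pfun _ (pfun_cst m r 0)) => x; rewrite subrr.
have [i] : exists i, i \in [set i | u 0 i != v 0 i].
  by apply/set0Pn; rewrite -card_gt0 hk.
rewrite inE => ui; pose w := upd u i (v 0 i).
have uw : u != w by apply: contraNneq ui => /rowP/(_ i); rewrite mxE eqxx => ->.
have hw : pfun r (fun x => (x == w)%:R - (x == v)%:R).
  apply: IH; apply/eqP; rewrite -eqSS -hk (cardsD1 i [set i | u 0 i != v 0 i]) inE ui add1n eqSS.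
  apply/eqP; apply: eq_card => l; rewrite !inE mxE.
  by case: (eqVneq l i) => [->|_]; rewrite ?eqxx.
suff hu : pfun r (fun x => (x == u)%:R - (x == w)%:R).
  apply: (eq_pfun _ (pfunD hu hw)) => x; ring.
pose A l := if l == i then [set u 0 i; v 0 i] else [set u 0 l].
have gridA : grid A = [set u; w].
  apply/setP => x; rewrite !inE; apply/forallP/orP => [h|h l].
    have xl l : l != i -> x 0 l = u 0 l.
      by move=> li; have := h l; rewrite /A (negPf li) inE => /eqP.
    have := h i; rewrite /A eqxx !inE => /orP[] /eqP xi; [left|right]; apply/eqP/rowP => l;
      rewrite ?mxE; case: (eqVneq l i) => [->//|]; exact: xl.
  rewrite /A; case: (eqVneq l i) => [->|li].
    by case: h => /eqP ->; rewrite !inE ?mxE ?eqxx ?orbT.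
  by case: h => /eqP ->; rewrite !inE ?mxE ?(negPf li).
pose f := grid_fun (fun l => ~: A l).
have fr : pfun r f.
  have := pfun_grid_compl A; suff -> : (\sum_l (q - #|A l|) = r)%N by [].
  apply/eqP; rewrite -eqSS rE -addn1.
  rewrite -(eqP (_ : \sum_(l < m) (l == i : nat) == 1)%N); last first.
    by rewrite (bigD1 i) //= eqxx big1 ?addn0 // => l /negPf ->.
  have -> : (m * q.-1 = \sum_(l < m) q.-1)%N by rewrite sum_nat_const card_ord.
  rewrite -big_split; apply/eqP; apply: eq_bigr => l _ /=.
  have arith2 a : (1 < a -> a - 2 + true = a.-1)%N by move=> /=; lia.
  have arith1 a : (a - 1 + false = a.-1)%N by move=> /=; lia.
  rewrite /A; case: (eqVneq l i) => [_|_]; last by rewrite cards1; exact: arith1.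
  by rewrite cards2 ui; exact: arith2 q1.
have fE x : (f x != 0) = (x == u) || (x == w) by rewrite grid_compl gridA !inE.
have fu : f u != 0 by rewrite fE eqxx.
have fw : f w = - f u.
  have := @sum_pfun0 F m r f _ fr; rewrite -rE ltnSn => /(_ isT).
  rewrite (bigD1 u) //= (bigD1 w) 1?eq_sym //= big1 ?addr0.
    by move/eqP; rewrite addrC addr_eq0 => /eqP.
  move=> x /andP[xu xw]; apply/eqP; rewrite -[_ == 0]negbK fE.
  by rewrite (negPf xu) (negPf xw).
apply: (eq_pfun _ (pfunZ (f u)^-1 fr)) => x.
case: (eqVneq x u) => [->|xu]; first by rewrite (negPf uw) mulVf // subr0.
case: (eqVneq x w) => [->|xw]; first by rewrite fw mulrN mulVf // sub0r.
suff -> : f x = 0 by rewrite mulr0 subrr.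
by apply/eqP; rewrite -[_ == 0]negbK fE (negPf xu) (negPf xw).
Qed.

(** The entries of a word sum to zero, so none is supported at one point, while any two points
    support the difference of their indicator functions. *)
Lemma equicardinal_subtop : r.+1 = (m * q.-1)%N -> equicardinal.
Proof.
move=> rE; apply: (@equicardinal_uniform 1).
  move=> g D gr gD D1 x; case: (boolP (x \in D)) => [xD|/gD//].
  apply: (@pfun_point F m r 0 g (fun _ => 1) x _ gr (pfun_cst m 0 1)).
  - by rewrite addn0 -rE.
  - move=> y yx; rewrite gD ?mul0r //; apply: contra yx => yD.
    by move/card_le1P: D1 => /(_ x xD y); rewrite yD inE => /esym.
  - by rewrite oner_eq0.
move=> D /eqP/cards2P[u [v [uv ->]]].
exists (fun x => (x == u)%:R - (x == v)%:R); split; first exact: pfun_delta_diff.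
  move=> x; rewrite !inE negb_or => /andP[/negPf -> /negPf ->]; by rewrite subrr.
by exists u; rewrite eqxx (negPf uv) subr0 oner_eq0.
Qed.

Lemma pfun1_affine g : pfun 1 g -> forall x w z (t : F),
  g (x + t *: (w - z)) = g x + t * (g w - g z).
Proof.
move=> [f fr fg] x w z t; rewrite !fg !mevalE -sumrB mulr_sumr -big_split.
apply: eq_big_seq => k /fr; rewrite leq_eqVlt ltnS leqn0 mdeg_eq0 => /orP[|/eqP ->] /=.
  have E (i : 'I_m) (y : pt) : \prod_j y 0 j ^+ (U_(i)%MM : 'X_{1..m}) j = y 0 i.
    rewrite (bigD1 i) //= mnm1E eqxx expr1 big1 ?mulr1 // => j ji.
    by rewrite mnm1E eq_sym (negPf ji) expr0.
  by move=> /mdeg1P[i /eqP ->]; rewrite !E !mxE; ring.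
have E (y : pt) : \prod_j y 0 j ^+ (0%MM : 'X_{1..m}) j = 1.
  by rewrite big1 // => j _; rewrite mnm0E expr0.
rewrite !E; ring.
Qed.

(* Nonzero affine functions with a zero all have the same weight, so counting the nonzero
   entries of the words of subcode C S in two ways determines #|S|. *)
Lemma equicardinal_1 : r = 1%N -> equicardinal.
Proof.
move=> r1; have q1 := card_gt1 F.
have const1 : const_mx 1 \in C.
  have -> : const_mx 1 = \row_j 1 :> 'rV[F]_N by apply/rowP => j; rewrite !mxE.
  exact: mem_reed_muller hC (pfun_cst m r 1).
(* The set of all positions is treated apart, as it carries the constant words, which have no zero;
   a set of the same nullity carries the all-one word. *)
have full S T : S = setT -> nu S = nu T -> T = setT.
  move=> -> hT; apply/setP => j; rewrite inE; apply/negPn/negP => jT.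
  have : const_mx 1 \in subcode C T.
    have : \dim (subcode C T) == \dim C by rewrite -(code_nullity_setT C) hT.
    have sC : (subcode C T <= C)%VS by apply/subvP => c /subcodeP[].
    by rewrite (dimv_leqif_sup sC).2 => /subvP; exact.
  by move=> /subcodeP[_ /(_ j jT)]; rewrite mxE => /eqP; rewrite oner_eq0.
have count S : S != setT -> coloop_free nu S ->
    (#|S| * q ^ nu S = (q ^ nu S).-1 * q ^ m)%N.
  move=> ST /coloop_freeP cS.
  have /set0Pn[z] : ~: S != set0.
    by apply: contraNneq ST => h; rewrite -[S]setCK h setC0.
  rewrite inE => zS.
  pose U := [set c | c \in subcode C S].
  have cU : #|U| = (q ^ nu S)%N by rewrite cardsE card_vspace.
  pose w (c : 'rV[F]_N) := #|[set j | c 0 j != 0]|.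
  (* Count by positions: at each j in S some word c0 of the subcode is nonzero, and adding its
     multiples equidistributes the values at j. *)
  have h1 : (q * \sum_(c in U) w c = #|S| * (q.-1 * #|U|))%N.
    rewrite /w; under eq_bigr do rewrite -sum1_card.
    rewrite (exchange_big_dep (mem S)) /=; last first.
      move=> c j; rewrite !inE => /subcodeP[_ hc]; apply: contraNT => /hc ->.
      by rewrite eqxx.
    rewrite big_distrr -sum_nat_const /=; apply: eq_bigr => j jS.
    have [c0 c0U c0j] := cS j jS.
    rewrite -(@equidistributed F _ U (fun c => c 0 j) (fun t c => c + (t / c0 0 j) *: c0)).
    + congr (_ * _)%N; rewrite -sum1_card; apply: eq_bigl => c; rewrite !inE.
      by rewrite andbC andbC.
    + by move=> t; exact: addIr.
    + by move=> t c; rewrite !inE => cU'; rewrite rpredD ?rpredZ.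
    + by move=> t c _; rewrite !mxE divfK.
  (* Count by words: the affine function g of a nonzero word vanishes at P z, as z is outside S, and
     not at some P j, so translations along P j - P z equidistribute its values. *)
  have h2 c : c \in U -> c != 0 -> (q * w c = q.-1 * q ^ m)%N.
    rewrite inE => /subcodeP[cC hc] c0.
    have [g gr cg] := reed_muller_pfun hC cC; rewrite r1 in gr.
    have [j cj] : exists j, c 0 j != 0.
      case: (pickP (fun j => c 0 j != 0)) => [j cj|h]; first by exists j.
      by case/eqP: c0; apply/rowP => j; rewrite mxE; apply/eqP/negbFE/h.
    have gz : g (P z) = 0 by rewrite -cg hc.
    have gj : g (P j) != 0 by rewrite -cg.
    have -> : w c = #|[set x in [set: pt] | g x != 0]|.
      rewrite -card_points; apply: eq_card => i; by rewrite !inE cg.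
    rewrite (@equidistributed F _ setT g (fun t x => x + (t / g (P j)) *: (P j - P z))).
    + by rewrite cardsT card_mx mul1n.
    + by move=> t; exact: addIr.
    + by move=> t x _; rewrite inE.
    + by move=> t x _; rewrite pfun1_affine // gz subr0 divfK.
  have : (q * \sum_(c in U) w c = #|U|.-1 * (q.-1 * q ^ m))%N.
    have U0 : 0 \in U by rewrite inE mem0v.
    rewrite (bigD1 0) //= [w 0](_ : _ = 0)%N ?add0n; last first.
      by apply: eq_card0 => j; rewrite !inE mxE eqxx.
    rewrite big_distrr /= (eq_bigr (fun _ => q.-1 * q ^ m)%N); last first.
      by move=> c /andP[cU' c0]; exact: h2.
    rewrite sum_nat_const; congr (_ * _)%N.
    rewrite (cardsD1 0 U) U0 /= -[RHS]/(#|_|); apply: eq_card => c.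
    by rewrite in_setD1 andbC.
  rewrite h1 cU mulnCA [RHS]mulnCA => /eqP; rewrite eqn_pmul2l; first by move/eqP.
  by lia.
move=> S T cS cT hST.
case: (eqVneq S setT) => [hS|hS]; first by rewrite hS (full S T).
case: (eqVneq T setT) => [hT|hT]; first by rewrite hT (full T S).
have := count S hS cS; rewrite hST -(count T hT cT) => /eqP.
by rewrite eqn_pmul2r ?expn_gt0 => [/eqP//|]; rewrite (ltnW q1).
Qed.

End ReedMuller.

Theorem theorem10 (q : nat) (F : finFieldType) (hq : #|F| = q)
    (m r : nat) (hm : (1 <= m)%N) (hr : (r <= m * (q - 1))%N)
    (P : 'I_(q ^ m) -> 'rV[F]_m) (hP : bijective P)
    (C : {vspace 'rV[F]_(q ^ m)}) (hC : is_reed_muller r P C)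
    (H : 'M[F]_(q ^ m - \dim C, q ^ m)) (hH : parity_check H) :
  (forall E : free_seq F (q ^ m),
     minimal_graded_resolution (\dim C) (sr_ideal (code_face H)) E ->
     pure (\dim C) E)
  <-> (m = 1%N \/ (r <= 1)%N \/ (m * (q - 1) - 1 <= r)%N).
Proof.
have q1 : (1 < q)%N by rewrite -hq card_gt1.
have qE : #|F|.-1 = (q - 1)%N by rewrite hq subn1.
split=> [hpure|cond]; last first.
  apply: (pure_of_equicardinal hH).
  have [r0|r0] := eqVneq r 0%N; first exact: equicardinal_0 hP hC r0.
  have [r1|r1] := eqVneq r 1%N; first exact: equicardinal_1 hP hC r1.
  have [rt|rt] := eqVneq r (m * (q - 1))%N.
    by apply: (equicardinal_top hP hC); rewrite qE.
  have [rs|rs] := eqVneq r.+1 (m * (q - 1))%N.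
    by apply: (equicardinal_subtop hP hC); rewrite qE.
  case: cond => [m1|cond]; last by exfalso; lia.
  by apply: (equicardinal_m1 hP hC m1); move: hr; rewrite m1 mul1n qE.
case: (eqVneq m 1%N) => [->|m1]; first by left.
right; case: (leqP r 1) => [|r2]; first by left.
right; rewrite leqNgt; apply/negP => rlt.
have [D [D' [cD cD' neq]]] : exists D D' : {set 'rV[F]_m},
    [/\ rm_circuit r D, rm_circuit r D' & #|D| <> #|D'|].
  have [q2|q2] := eqVneq q 2%N.
    by apply: two_circuits_2; rewrite ?hq //; move: rlt; rewrite q2; lia.
  by apply: two_circuits_gt2; rewrite ?qE ?hq; lia.
exact: neq (rm_circuits_equal hP hC hH hpure cD cD').
Qed.
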